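(* Let $\mathcal T=[t_{i_1,\ldots,i_d}]\in\mathbb R^{n^{\times d}}_{ps,+}$ be weakly irreducible, and let $u>0$ satisfy $\mathcal T(u)=\rho(\mathcal T)u^{\circ(d-1)}$. (1) There exist functions $z(\mathcal R)\in\mathbb C^n$ and $\lambda(\mathcal R)\in\mathbb C$, analytic in the entries of $\mathcal R\in\mathbb C^{n^{\times d}}_{ps}$ and defined in a neighborhood of $\mathcal T$, such that $\mathcal R(z(\mathcal R))=\lambda(\mathcal R)\,z(\mathcal R)^{\circ(d-1)}$ in this neighborhood, $z(\mathcal T)=u$ and $\lambda(\mathcal T)=\rho(\mathcal T)$. (2) Let $\mathcal S=[s_{i_1,\ldots,i_d}]\in\mathbb R^{n^{\times d}}_{ps}$ be such that $s_{i_1,\ldots,i_d}\ge0$ whenever $t_{i_1,\ldots,i_d}=0$. Then, for small $\epsilon\ge0$, $$\rho(\mathcal T+\epsilon\mathcal S)=\rho(\mathcal T)+\epsilon\,w^\top\operatorname{diag}(u)^{-(d-2)}\mathcal S(u)+O(\epsilon^2),$$ where $w>0$ is the unique vector with $A^\top w=(d-1)\rho(\mathcal T)w$ and $w^\top u=1$, $A=\operatorname{diag}(u)^{-(d-2)}D\mathcal T(u)$.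
   Context: Let $n\ge1$, $d\ge3$ be integers, $[n]=\{1,\dots,n\}$. For $\mathbb F\in\{\mathbb R,\mathbb C\}$, $\mathbb F^{n^{\times d}}_{ps}$ is the space of tensors $\mathcal T=[t_{i_1,\dots,i_d}]$, $i_1,\dots,i_d\in[n]$, with entries in $\mathbb F$ symmetric in the last $d-1$ indices; $\mathbb R^{n^{\times d}}_{ps,+}$ is the subset with nonnegative entries. For $x\in\mathbb C^n$, $\mathcal T(x)_i=\sum_{i_2,\dots,i_d\in[n]}t_{i,i_2,\dots,i_d}x_{i_2}\cdots x_{i_d}$, and $x^{\circ p}=(x_1^p,\dots,x_n^p)^\top$. An eigenvalue of $\mathcal T$ is $\lambda\in\mathbb C$ with $\mathcal T(x)=\lambda x^{\circ(d-1)}$ for some nonzero $x\in\mathbb C^n$; $\rho(\mathcal T)$ is the maximum modulus of the eigenvalues. For vectors, $x>0$ means all entries are positive. A nonnegative $\mathcal T$ is weakly irreducible if the digraph on $[n]$ with an edge $(i,j)$ whenever $t_{i,j_1,\dots,j_{d-1}}>0$ for some $j_1,\dots,j_{d-1}$ with $j\in\{j_1,\dots,j_{d-1}\}$ is strongly connected. In that case $u>0$ with $\mathcal T(u)=\rho(\mathcal T)u^{\circ(d-1)}$ exists and is unique up to positive scaling. $D\mathcal T(u)\in\mathbb R^{n\times n}$ has entries $D\mathcal T(u)_{ij}=(d-1)\sum_{i_3,\dots,i_d}t_{i,j,i_3,\dots,i_d}u_{i_3}\cdots u_{i_d}$; the matrix $A$ is nonnegative irreducible with $Au=(d-1)\rho(\mathcal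 T)u$, so $w$ exists and is unique. *)

(* Defs.v *)
From mathcomp Require Import all_boot all_order all_algebra.
From mathcomp Require Import complex.
From mathcomp Require Import all_classical reals topology normedtype sequences.

Set Implicit Arguments.
Unset Strict Implicit.
Unset Printing Implicit Defensive.

Import Order.TTheory GRing.Theory Num.Theory.
Import numFieldNormedType.Exports.

Local Open Scope classical_set_scope.
Local Open Scope ring_scope.

(* The index (i_1, ..., i_d) is the tuple [:: i_1; ...; i_d], 0-based in each
   coordinate. *)
Definition tensor (K : Type) (n d : nat) : Type := {ffun d.-tuple 'I_n -> K}.

Definition partially_symmetric (K : Type) (n d : nat) (T : tensor K n d) : Prop :=
  forall I J : d.-tuple 'I_n,
    take 1 I = take 1 J -> perm_eq (drop 1 I) (drop 1 J) -> T I = T J.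

Definition tensor_app (K : pzRingType) (n d : nat) (T : tensor K n d)
    (x : 'cV[K]_n) : 'cV[K]_n :=
  \col_i \sum_(I : d.-tuple 'I_n | take 1 I == [:: i])
            T I * \prod_(k <- drop 1 I) x k 0.

Definition hadamard_exp (K : pzRingType) (n : nat) (x : 'cV[K]_n) (p : nat) :
    'cV[K]_n :=
  map_mx (fun c => c ^+ p) x.

Definition tensor_deriv (K : pzRingType) (n d : nat) (T : tensor K n d)
    (u : 'cV[K]_n) : 'M[K]_n :=
  \matrix_(i, j) ((d - 1)%:R *
    \sum_(I : d.-tuple 'I_n | take 2 I == [:: i; j])
       T I * \prod_(k <- drop 2 I) u k 0).

Definition positive_vec (K : numDomainType) (n : nat) (x : 'cV[K]_n) : Prop :=
  forall i, 0 < x i 0.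

Definition nonneg_tensor (K : numDomainType) (n d : nat) (T : tensor K n d) :
    Prop :=
  forall I, 0 <= T I.

Definition tensor_edge (K : numDomainType) (n d : nat) (T : tensor K n d) :
    rel 'I_n :=
  fun i j => [exists I : d.-tuple 'I_n,
    [&& take 1 I == [:: i], j \in drop 1 I & 0 < T I]].

Definition weakly_irreducible (K : numDomainType) (n d : nat)
    (T : tensor K n d) : Prop :=
  forall i j, connect (tensor_edge T) i j.

Definition tensor_eigenvalue (K : pzRingType) (n d : nat) (T : tensor K n d)
    (lambda : K) : Prop :=
  exists2 x : 'cV[K]_n, x != 0
    & tensor_app T x = lambda *: hadamard_exp x (d - 1).

Definition complexify (R : rcfType) (n d : nat) (T : tensor R n d) :
    tensor R[i] n d :=
  [ffun I => (T I)%:C%C].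

Definition eigenvalue_moduli (R : rcfType) (n d : nat) (T : tensor R n d) :
    set R :=
  [set r | exists2 lambda : R[i],
     tensor_eigenvalue (complexify T) lambda & `|lambda| = r%:C%C].

(* The maximum of the moduli of the complex eigenvalues; 0 is the dummy value
   for a set without maximum. *)
Definition spectral_radius (R : rcfType) (n d : nat) (T : tensor R n d) : R :=
  xget 0 [set r | eigenvalue_moduli T r /\ ubound (eigenvalue_moduli T) r].

Definition polydisc (K : numFieldType) (I : finType) (a : {ffun I -> K})
    (r : K) : set {ffun I -> K} :=
  [set x | forall i, `|x i - a i| < r].

(* The multi-indices of total degree k over I have all coordinates at most k,
   so they are exactly the m : {ffun I -> 'I_k.+1} with coordinate sum k. *)
Definition homogeneous_part (K : numFieldType) (I : finType)
    (c : {ffun I -> nat} -> K) (h : {ffun I -> K}) (k : nat) : K :=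
  \sum_(m : {ffun I -> 'I_k.+1} | (\sum_i m i)%N == k)
     c [ffun i => m i : nat] * \prod_i h i ^+ m i.

(* f, restricted to E, is given near a by a power series in the coordinates of
   x - a that converges absolutely on E near a.  Summing by total degree is
   harmless because of the absolute convergence.  When E is a proper subspace
   the coordinates are redundant and c is not unique, but expanding in the
   coordinates of I or in linearly independent coordinates on E is the same. *)
Definition analytic_at_within (K : numFieldType) (I : finType)
    (E : set {ffun I -> K}) (f : {ffun I -> K} -> K) (a : {ffun I -> K}) :
    Prop :=
  exists2 r : K, 0 < r & exists c : {ffun I -> nat} -> K,
    forall x, E x -> polydisc a r x ->
      cvgn (series (homogeneous_part (fun m => `|c m|)
                                     [ffun i => `|x i - a i|])) /\
      series (homogeneous_part c [ffun i => x i - a i]) @ \oo --> f x.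

(* Main.v *)
Require Import Defs.
From mathcomp Require Import all_boot all_order all_algebra.
From mathcomp Require Import complex.
From mathcomp Require Import all_classical reals topology normedtype sequences.
From mathcomp Require Import ring lra.

Set Implicit Arguments.
Unset Strict Implicit.
Unset Printing Implicit Defensive.

Import Order.TTheory GRing.Theory Num.Theory.
Import numFieldNormedType.Exports.

Local Open Scope ring_scope.

(* A polynomial is measured by the l1 norm of its Taylor coefficients at a
   point, weighted by the powers of a radius.  This norm is submultiplicative, shrinks
   the radius by the distance when the centre is moved, and a sequence of
   polynomials whose increments are summable in it converges to a function that
   is analytic at every point of the polydisc.  Hence a polynomial fixed-point
   equation y = Phi(x, y) with vanishing y-derivative has an analytic solution,
   by Picard iteration in this norm.

   The eigenvector equation is put in that form with the normalisation
   lambda = rho + w^T (z - u): its derivative in z, multiplied by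
   diag(u)^-(d-2), is A - (d-1) rho I - u w^T, which is invertible since the
   Perron eigenvalue of the irreducible matrix A is simple.

   The solution is real and positive at T + eps S for small eps, so there
   lambda is the spectral radius.  If y solves the linearised equation, then
   u + eps y satisfies the eigenvector equation of T + eps S with the eigenvalue
   rho + eps w^T y up to O(eps^2), and the Collatz-Wielandt inequalities turn
   this into the expansion of the spectral radius. *)

(** * Modulus and dyadic sequences *)

(** The norm on [R[i]] is itself valued in [R[i]]; its real part carries the same information in the
    ordered field [R], where suprema and linear arithmetic apply. *)
Definition cabs {R : rcfType} (z : R[i]) : R := complex.Re `|z|.

Lemma cabsE (R : rcfType) (z : R[i]) : `|z| = (cabs z)%:C%C.
Proof. by rewrite /cabs RRe_real // normr_real. Qed.

Lemma cabs_ge0 (R : rcfType) (z : R[i]) : 0 <= cabs z.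
Proof. by rewrite -lecR -cabsE normr_ge0. Qed.

Lemma cabs_eq0 (R : rcfType) (z : R[i]) : (cabs z == 0) = (z == 0).
Proof. by rewrite -(inj_eq (@complexI R)) -cabsE normr_eq0. Qed.

Lemma cabs0 (R : rcfType) : cabs (0 : R[i]) = 0.
Proof. by apply/eqP; rewrite cabs_eq0. Qed.

Lemma cabsD (R : rcfType) (x y : R[i]) : cabs (x + y) <= cabs x + cabs y.
Proof. by rewrite -lecR rmorphD -!cabsE ler_normD. Qed.

Lemma cabsM (R : rcfType) (x y : R[i]) : cabs (x * y) = cabs x * cabs y.
Proof. by apply: complexI; rewrite rmorphM -!cabsE normrM. Qed.

Lemma cabsN (R : rcfType) (x : R[i]) : cabs (- x) = cabs x.
Proof. by apply: complexI; rewrite -!cabsE normrN. Qed.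

Lemma cabsX (R : rcfType) (x : R[i]) k : cabs (x ^+ k) = cabs x ^+ k.
Proof. by apply: complexI; rewrite rmorphXn -!cabsE normrX. Qed.

Lemma cabsB (R : rcfType) (x y : R[i]) : cabs (x - y) = cabs (y - x).
Proof. by rewrite -opprB cabsN. Qed.

Lemma cabs_distD (R : rcfType) (y x z : R[i]) :
  cabs (x - z) <= cabs (x - y) + cabs (y - z).
Proof. by apply: le_trans (cabsD _ _); rewrite addrA subrK. Qed.

Lemma cabs_real (R : rcfType) (x : R) : cabs x%:C%C = `|x|.
Proof. by apply: complexI; rewrite -cabsE normc_def /= expr0n addr0 sqrtr_sqr. Qed.

Lemma cabs_conj (R : rcfType) (x : R[i]) : cabs x^*%C = cabs x.
Proof. by rewrite /cabs normcJ. Qed.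

Lemma cabs_sum (R : rcfType) (J : Type) (s : seq J) (P : pred J)
    (F : J -> R[i]) :
  cabs (\sum_(j <- s | P j) F j) <= \sum_(j <- s | P j) cabs (F j).
Proof.
elim/big_rec2: _ => [|j x y _ le_xy]; first by rewrite cabs0.
by rewrite (le_trans (cabsD _ _))// lerD2l.
Qed.

Lemma cabs_prod (R : rcfType) (J : Type) (s : seq J) (P : pred J)
    (F : J -> R[i]) :
  cabs (\prod_(j <- s | P j) F j) = \prod_(j <- s | P j) cabs (F j).
Proof.
apply: complexI; rewrite rmorph_prod -cabsE normr_prod.
by apply: eq_bigr => j _; rewrite cabsE.
Qed.

Lemma cabs_le_ReIm (R : rcfType) (a b : R) :
  cabs (Complex a b) <= `|a| + `|b|.
Proof.
rewrite -lecR -cabsE normc_def lecR /=.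
rewrite -[leRHS]ger0_norm ?addr_ge0// -[leRHS]sqrtr_sqr ler_wsqrtr//.
rewrite sqrrD !real_normK ?num_real// [leRHS]addrAC lerDl.
by rewrite mulrn_wge0// mulr_ge0.
Qed.

Lemma Re_le_cabs (R : rcfType) (z : R[i]) : `|complex.Re z| <= cabs z.
Proof. by rewrite -lecR -cabsE normc_ge_Re. Qed.

Lemma Im_le_cabs (R : rcfType) (z : R[i]) : `|complex.Im z| <= cabs z.
Proof.
rewrite -lecR -cabsE normc_def lecR -[leLHS]sqrtr_sqr ler_wsqrtr//.
by rewrite lerDr sqr_ge0.
Qed.

Lemma dyadic_small (R : realType) (B e : R) :
  0 < e -> exists k, B * 2^-1 ^+ k <= e.
Proof.
move=> e0; have [B0|B0] := lerP B 0.
  by exists 0%N; rewrite expr0 mulr1 (le_trans B0) ?ltW.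
(* This exponent [k] exceeds [B / e], and [k < 2 ^ k]. *)
exists (Num.Def.trunc (B / e)).+1.
rewrite exprVn ler_pdivrMr ?exprn_gt0// -ler_pdivrMl// mulrC.
apply: (le_trans (ltW (truncnS_gt _))).
by rewrite -natrX ler_nat ltnW// ltn_expl.
Qed.

(** Limits in the estimates below are taken this way: a geometric error with any fixed constant may
    be dropped. *)
Lemma dyadic_le (R : realType) (x y B : R) :
  (forall k, x <= y + B * 2^-1 ^+ k) -> x <= y.
Proof.
move=> H; apply/ler_addgt0Pr => e e0.
have [k Hk] := dyadic_small B e0.
by apply: (le_trans (H k)); rewrite lerD2l.
Qed.

(** The geometric sum is kept with its subtracted remainder, so that the induction on [j] closes. *)
Lemma dyadic_tail (R : realFieldType) (x : nat -> R) (M : R) k j :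
  (forall k, `|x k.+1 - x k| <= M * 2^-1 ^+ k) ->
  `|x (k + j)%N - x k| <= 2 * M * 2^-1 ^+ k - 2 * M * 2^-1 ^+ (k + j).
Proof.
move=> H; elim: j => [|j IH]; first by rewrite addn0 !subrr normr0.
rewrite addnS exprS; have := H (k + j)%N; set u := 2^-1 ^+ (k + j) in IH *.
move=> H1; have -> : x (k + j).+1 - x k
  = (x (k + j).+1 - x (k + j)%N) + (x (k + j)%N - x k) by ring.
by apply: (le_trans (ler_normD _ _)); lra.
Qed.

(** All the numbers [x k - 2 M 2^-k] lie below all the [x j + 2 M 2^-j], so the supremum of the
    former separates the two families; this gives the limit together with its rate. *)
Lemma dyadic_lim (R : realType) (x : nat -> R) (M : R) :
  (forall k, `|x k.+1 - x k| <= M * 2^-1 ^+ k) ->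
  exists l, forall k, `|l - x k| <= 2 * M * 2^-1 ^+ k.
Proof.
move=> H; have M0 : 0 <= M by have := H 0%N; rewrite expr0 mulr1; apply: le_trans.
have hk k : 0 <= M * 2^-1 ^+ k by rewrite mulr_ge0// exprn_ge0// invr_ge0.
have tl k j := @dyadic_tail _ x M k j H.
pose b k := x k - 2 * M * 2^-1 ^+ k.
have ba k j : b k <= x j + 2 * M * 2^-1 ^+ j.
  rewrite /b; have [kj|jk] := leqP k j.
    have := tl k (j - k)%N; rewrite subnKC// ler_norml => /andP[].
    by have := hk j; have := hk k; lra.
  have := tl j (k - j)%N; rewrite subnKC; last exact: ltnW.
  rewrite ler_norml => /andP[].
  by have := hk j; have := hk k; lra.
pose E : set R := [set y | exists k, y = b k]%classic.
exists (sup E) => k.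
rewrite ler_norml; apply/andP; split.
  have : b k <= sup E.
    apply: ub_le_sup; last by exists k.
    by exists (x 0%N + 2 * M * 2^-1 ^+ 0) => _ [j ->]; exact: ba.
  by rewrite /b; lra.
have : sup E <= x k + 2 * M * 2^-1 ^+ k.
  apply: ge_sup; first by exists (b 0%N), 0%N.
  by move=> _ [j ->]; exact: ba.
by lra.
Qed.

Lemma dyadic_limC (R : realType) (x : nat -> R[i]) (M : R) :
  (forall k, cabs (x k.+1 - x k) <= M * 2^-1 ^+ k) ->
  exists l, forall k, cabs (l - x k) <= 4 * M * 2^-1 ^+ k.
Proof.
move=> H.
have [a Ha] : exists l, forall k, `|l - complex.Re (x k)| <= 2 * M * 2^-1 ^+ k.
  apply: dyadic_lim => k; apply: le_trans (H k).
  by rewrite -raddfB Re_le_cabs.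
have [b Hb] : exists l, forall k, `|l - complex.Im (x k)| <= 2 * M * 2^-1 ^+ k.
  apply: dyadic_lim => k; apply: le_trans (H k).
  by rewrite -raddfB Im_le_cabs.
exists (Complex a b) => k; move: (Ha k) (Hb k); case: (x k) => c e /= h1 h2.
by apply: (le_trans (cabs_le_ReIm _ _)); lra.
Qed.

(** * Polynomials with a weighted l1 norm *)

(* A polynomial is a list of pairs (coefficient, multi-index), in which a
   multi-index may occur several times. *)
Definition poly_eval (K : pzRingType) (I : finType)
    (s : seq (K * {ffun I -> nat})) (h : {ffun I -> K}) : K :=
  \sum_(p <- s) p.1 * \prod_i h i ^+ p.2 i.

Definition poly_coef (K : pzRingType) (I : finType)
    (s : seq (K * {ffun I -> nat})) (m : {ffun I -> nat}) : K :=
  \sum_(p <- s | p.2 == m) p.1.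

Definition poly_norm (R : rcfType) (I : finType) (r : R)
    (s : seq (R[i] * {ffun I -> nat})) : R :=
  \sum_(p <- s) cabs p.1 * r ^+ (\sum_i p.2 i)%N.

Lemma homogeneous_part_poly_coef (K : numFieldType) (I : finType)
    (s : seq (K * {ffun I -> nat})) (h : {ffun I -> K}) k :
  homogeneous_part (poly_coef s) h k =
  \sum_(p <- s | (\sum_i p.2 i)%N == k) p.1 * \prod_i h i ^+ p.2 i.
Proof.
rewrite /homogeneous_part /poly_coef.
under eq_bigr do rewrite big_mkcond mulr_suml.
rewrite exchange_big /= [RHS]big_mkcond; apply: eq_bigr => -[c mu] _ /=.
case: eqP => Hk; last first.
  rewrite big1// => m /eqP Hm; case: eqP => [E|]; last by rewrite mul0r.
  case: Hk; apply: etrans Hm; rewrite E.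
  by apply: eq_bigr => i _; rewrite ffunE.
(* No coordinate of [mu] exceeds its degree [k], so [mu] is an index of the sum, and the only one
   that contributes. *)
have mule i : (mu i < k.+1)%N by rewrite ltnS -Hk (bigD1 i)//= leq_addr.
pose m0 : {ffun I -> 'I_k.+1} := [ffun i => Ordinal (mule i)].
have m0E : [ffun i => m0 i : nat] = mu by apply/ffunP => i; rewrite !ffunE.
rewrite (bigD1 m0) /=; last first.
  by apply/eqP; apply: etrans Hk; apply: eq_bigr => i _; rewrite ffunE.
rewrite m0E eqxx [X in _ + X]big1 ?addr0; last first.
  move=> m /andP[_ mm0]; case: eqP => [E|]; last by rewrite mul0r.
  case/eqP: mm0; apply/ffunP => i; apply: val_inj => /=.
  by move/ffunP/(_ i): E; rewrite !ffunE => <-.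
by congr (_ * _); apply: eq_bigr => i _; rewrite ffunE.
Qed.

Lemma homogeneous_partD (K : numFieldType) (I : finType)
    (c c' : {ffun I -> nat} -> K) h k :
  homogeneous_part (fun m => c m + c' m) h k =
  homogeneous_part c h k + homogeneous_part c' h k.
Proof.
rewrite /homogeneous_part -big_split /=.
by apply: eq_bigr => m _; rewrite mulrDl.
Qed.

Lemma homogeneous_partN (K : numFieldType) (I : finType)
    (c : {ffun I -> nat} -> K) h k :
  homogeneous_part (fun m => - c m) h k = - homogeneous_part c h k.
Proof.
by rewrite /homogeneous_part -sumrN; apply: eq_bigr => m _; rewrite mulNr.
Qed.

Lemma homogeneous_partZ (K : numFieldType) (I : finType) (x : K)
    (c : {ffun I -> nat} -> K) h k :
  homogeneous_part (fun m => x * c m) h k = x * homogeneous_part c h k.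
Proof.
rewrite /homogeneous_part mulr_sumr.
by apply: eq_bigr => m _; rewrite mulrA.
Qed.

Lemma homogeneous_part_ge0 (K : numFieldType) (I : finType)
    (c : {ffun I -> nat} -> K) (h : {ffun I -> K}) k :
  (forall i, 0 <= h i) -> (forall m, 0 <= c m) ->
  0 <= homogeneous_part c h k.
Proof.
move=> h0 c0; apply: sumr_ge0 => m _; rewrite mulr_ge0// prodr_ge0// => i _.
by rewrite exprn_ge0.
Qed.

Lemma homogeneous_part_le (K : numFieldType) (I : finType)
    (c c' : {ffun I -> nat} -> K) (h : {ffun I -> K}) k :
  (forall i, 0 <= h i) -> (forall m, c m <= c' m) ->
  homogeneous_part c h k <= homogeneous_part c' h k.
Proof.
move=> h0 cc'; rewrite -subr_ge0 -homogeneous_partN -homogeneous_partD.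
by apply: homogeneous_part_ge0 => // m; rewrite subr_ge0.
Qed.

Lemma cabs_homogeneous_part (R : rcfType) (I : finType)
    (c : {ffun I -> nat} -> R[i]) (h : {ffun I -> R[i]}) k :
  cabs (homogeneous_part c h k) <=
  homogeneous_part (cabs \o c) [ffun i => cabs (h i)] k.
Proof.
rewrite /homogeneous_part (le_trans (cabs_sum _ _ _))// ler_sum// => m _.
rewrite cabsM cabs_prod ler_wpM2l ?cabs_ge0// ler_prod// => i _.
by rewrite ffunE cabsX lexx exprn_ge0 ?cabs_ge0.
Qed.

Lemma homogeneous_part_norm (R : rcfType) (I : finType)
    (c : {ffun I -> nat} -> R[i]) (h : {ffun I -> R[i]}) k :
  homogeneous_part (fun m => `|c m|) [ffun i => `|h i|] k =
  (homogeneous_part (cabs \o c) [ffun i => cabs (h i)] k)%:C%C.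
Proof.
rewrite /homogeneous_part rmorph_sum; apply: eq_bigr => m _.
rewrite rmorphM rmorph_prod cabsE; congr (_ * _).
by apply: eq_bigr => i _; rewrite !ffunE rmorphXn cabsE.
Qed.

Lemma cabs_poly_coef (R : rcfType) (I : finType)
    (s : seq (R[i] * {ffun I -> nat})) m :
  cabs (poly_coef s m) <= poly_coef [seq (cabs p.1, p.2) | p <- s] m.
Proof. by rewrite /poly_coef big_map cabs_sum. Qed.

Lemma poly_norm_ge0 (R : rcfType) (I : finType) (r : R)
  (s : seq (R[i] * {ffun I -> nat})) : 0 <= r -> 0 <= poly_norm r s.
Proof.
by move=> r0; apply: sumr_ge0 => p _; rewrite mulr_ge0 ?cabs_ge0 ?exprn_ge0.
Qed.

Lemma poly_eval_cat (K : pzRingType) (I : finType)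
    (s s' : seq (K * {ffun I -> nat})) h :
  poly_eval (s ++ s') h = poly_eval s h + poly_eval s' h.
Proof. by rewrite /poly_eval big_cat. Qed.

Lemma poly_coef_cat (K : pzRingType) (I : finType)
    (s s' : seq (K * {ffun I -> nat})) m :
  poly_coef (s ++ s') m = poly_coef s m + poly_coef s' m.
Proof. by rewrite /poly_coef big_cat. Qed.

Lemma poly_norm_cat (R : rcfType) (I : finType) (r : R)
    (s s' : seq (R[i] * {ffun I -> nat})) :
  poly_norm r (s ++ s') = poly_norm r s + poly_norm r s'.
Proof. by rewrite /poly_norm big_cat. Qed.

Lemma monomial_le (R : numDomainType) (I : finType) (r : R) (t : I -> R)
    (mu : I -> nat) :
  (forall i, 0 <= t i <= r) ->
  0 <= \prod_i t i ^+ mu i <= r ^+ (\sum_i mu i)%N.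
Proof.
move=> tr; have t0 i : 0 <= t i by case/andP: (tr i).
rewrite prodr_ge0/=; last by move=> i _; rewrite exprn_ge0.
rewrite expr_sum ler_prod// => i _; rewrite exprn_ge0//=.
by have /andP[? ?] := tr i; rewrite lerXn2r// nnegrE (le_trans (t0 i)).
Qed.

Lemma poly_coef_norm (R : rcfType) (I : finType) (r : R)
    (s : seq (R[i] * {ffun I -> nat})) (t : {ffun I -> R}) n :
  (forall i, 0 <= t i <= r) ->
  \sum_(0 <= k < n) homogeneous_part (cabs \o poly_coef s) t k
    <= poly_norm r s.
Proof.
move=> tr; have t0 i : 0 <= t i by case/andP: (tr i).
pose a p := cabs p.1 * \prod_i t i ^+ (p.2 : {ffun I -> nat}) i.
have a0 (p : R[i] * {ffun I -> nat}) : 0 <= a p.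
  by rewrite mulr_ge0 ?cabs_ge0//; case/andP: (monomial_le p.2 tr).
have le1 k : homogeneous_part (cabs \o poly_coef s) t k <=
    \sum_(p <- s | (\sum_i p.2 i)%N == k) a p.
  rewrite (le_trans (homogeneous_part_le _ t0 (cabs_poly_coef s)))//.
  by rewrite homogeneous_part_poly_coef big_map.
rewrite (le_trans (ler_sum _ (fun k _ => le1 k)))//.
under eq_bigr do rewrite big_mkcond.
rewrite exchange_big /= /poly_norm; apply: ler_sum => p _.
apply: (@le_trans _ _ (a p)); last first.
  by rewrite ler_wpM2l ?cabs_ge0//; case/andP: (monomial_le p.2 tr).
(* A term of [s] has a single total degree, so it is met at most once among the degrees below
   [n]. *)
rewrite -big_mkcond /=; under eq_bigl do rewrite eq_sym.
by rewrite big_nat1_eq /=; case: ifP.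
Qed.

Lemma poly_eval_homogeneous (K : numFieldType) (I : finType)
    (s : seq (K * {ffun I -> nat})) :
  exists N, forall (h : {ffun I -> K}) n, (N <= n)%N ->
    \sum_(0 <= k < n) homogeneous_part (poly_coef s) h k = poly_eval s h.
Proof.
(* This number exceeds the degree of every term and does not depend on [h]. *)
exists (\sum_(p <- s) (\sum_i p.2 i).+1)%N => h n Nn.
under eq_bigr do rewrite homogeneous_part_poly_coef big_mkcond.
rewrite exchange_big /= /poly_eval !big_seq; apply: eq_bigr => p ps.
rewrite -big_mkcond /=; under eq_bigl do rewrite eq_sym.
rewrite big_nat1_eq /= ifT//.
by apply: leq_trans Nn; rewrite (big_rem p)//= leq_addr.
Qed.

(* Any list of terms representing f may be used: merging terms with the same
   multi-index only lowers the norm. *)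
Definition poly_bound (R : rcfType) (I : finType) (a : {ffun I -> R[i]})
    (r : R) (f : {ffun I -> R[i]} -> R[i]) (M : R) : Prop :=
  exists2 s : seq (R[i] * {ffun I -> nat}),
    forall x, f x = poly_eval s [ffun i => x i - a i]
    & poly_norm r s <= M.

Section PolyBound.
Variables (R : rcfType) (I : finType).
Implicit Types (a b : {ffun I -> R[i]}) (r M : R) (f g : {ffun I -> R[i]} -> R[i]).

Lemma poly_bound_ext a r f g M :
  f =1 g -> poly_bound a r f M -> poly_bound a r g M.
Proof. by move=> fg [s fs sM]; exists s => // x; rewrite -fg. Qed.

Lemma poly_bound_le a r f M M' :
  M <= M' -> poly_bound a r f M -> poly_bound a r f M'.
Proof. by move=> MM' [s fs sM]; exists s => //; apply: le_trans MM'. Qed.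

Lemma poly_bound_ge0 a r f M : 0 <= r -> poly_bound a r f M -> 0 <= M.
Proof. by move=> r0 [s _]; apply: le_trans; exact: poly_norm_ge0. Qed.

Lemma poly_bound_cst a r (c : R[i]) : poly_bound a r (fun=> c) (cabs c).
Proof.
exists [:: (c, [ffun=> 0%N])].
  move=> x; rewrite /poly_eval big_seq1 big1 ?mulr1// => i _.
  by rewrite !ffunE expr0.
by rewrite /poly_norm big_seq1 /= big1 ?expr0 ?mulr1// => i _; rewrite ffunE.
Qed.

Lemma poly_bound0 a r : poly_bound a r (fun=> 0) 0.
Proof. by rewrite -[X in poly_bound _ _ _ X](@cabs0 R); exact: poly_bound_cst. Qed.

Lemma poly_bound_coord a r i : poly_bound a r (fun x => x i - a i) r.
Proof.
exists [:: (1, [ffun j => nat_of_bool (j == i)])].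
  move=> x; rewrite /poly_eval big_seq1 mul1r (bigD1 i)//= !ffunE eqxx expr1.
  rewrite big1 ?mulr1// => j /negPf ji.
  by rewrite !ffunE ji expr0.
rewrite /poly_norm big_seq1 /= (bigD1 i)//= ffunE eqxx big1 ?addn0.
  by rewrite expr1 -[X in cabs X]/((1 : R)%:C)%C cabs_real normr1 mul1r.
by move=> j /negPf ji; rewrite ffunE ji.
Qed.

Lemma poly_boundD a r f g M M' :
  poly_bound a r f M -> poly_bound a r g M' ->
  poly_bound a r (fun x => f x + g x) (M + M').
Proof.
move=> [s fs sM] [s' gs sM']; exists (s ++ s').
  by move=> x; rewrite fs gs /poly_eval big_cat.
by rewrite poly_norm_cat lerD.
Qed.

Lemma poly_boundM a r f g M M' :
  0 <= r -> poly_bound a r f M -> poly_bound a r g M' ->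
  poly_bound a r (fun x => f x * g x) (M * M').
Proof.
move=> r0 [s fs sM] [s' gs sM'].
exists [seq (p.1 * q.1, [ffun i => p.2 i + q.2 i]%N)
       | p : R[i] * {ffun I -> nat} <- s, q : R[i] * {ffun I -> nat} <- s'].
  move=> x; rewrite fs gs /poly_eval big_allpairs_dep /= mulr_suml.
  apply: eq_bigr => p _; rewrite mulr_sumr; apply: eq_bigr => q _.
  rewrite mulrACA -big_split /=; congr (_ * _); apply: eq_bigr => i _.
  by rewrite !ffunE exprD.
apply: (@le_trans _ _ (poly_norm r s * poly_norm r s')); last first.
  by rewrite ler_pM// poly_norm_ge0.
rewrite /poly_norm big_allpairs_dep /= mulr_suml ler_sum// => p _.
rewrite mulr_sumr ler_sum// => q _; rewrite cabsM mulrACA -exprD -big_split /=.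
by under eq_bigr do rewrite ffunE.
Qed.

Lemma poly_boundZ a r f M c :
  0 <= r -> poly_bound a r f M -> poly_bound a r (fun x => c * f x) (cabs c * M).
Proof. by move=> r0; apply: poly_boundM => //; exact: poly_bound_cst. Qed.

Lemma poly_boundN a r f M :
  poly_bound a r f M -> poly_bound a r (fun x => - f x) M.
Proof.
move=> [s fs sM]; exists [seq (- p.1, p.2) | p <- s].
  move=> x; rewrite fs /poly_eval big_map -sumrN.
  by apply: eq_bigr => p _; rewrite mulNr.
by rewrite /poly_norm big_map; under eq_bigr do rewrite cabsN.
Qed.

Lemma poly_bound_sum a r (J : Type) (s : seq J) (P : pred J)
    (F : J -> {ffun I -> R[i]} -> R[i]) (B : J -> R) :
  (forall j, P j -> poly_bound a r (F j) (B j)) ->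
  poly_bound a r (fun x => \sum_(j <- s | P j) F j x) (\sum_(j <- s | P j) B j).
Proof.
move=> FB; elim: s => [|j s IH].
  rewrite big_nil; apply: poly_bound_ext (poly_bound0 a r) => x.
  by rewrite big_nil.
rewrite big_cons; case: ifPn => [Pj|/negPf Pj].
  by apply: poly_bound_ext (poly_boundD (FB j Pj) IH) => x; rewrite big_cons Pj.
by apply: poly_bound_ext IH => x; rewrite big_cons Pj.
Qed.

Lemma poly_bound_prod a r (J : Type) (s : seq J) (P : pred J)
    (F : J -> {ffun I -> R[i]} -> R[i]) (B : J -> R) :
  0 <= r -> (forall j, P j -> poly_bound a r (F j) (B j)) ->
  poly_bound a r (fun x => \prod_(j <- s | P j) F j x)
    (\prod_(j <- s | P j) B j).
Proof.
move=> r0 FB; elim: s => [|j s IH].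
  rewrite big_nil -[X in poly_bound _ _ _ X]normr1 -cabs_real.
  by apply: poly_bound_ext (poly_bound_cst _ _ _) => x; rewrite big_nil.
rewrite big_cons; case: ifPn => [Pj|/negPf Pj].
  apply: poly_bound_ext (poly_boundM r0 (FB j Pj) IH) => x.
  by rewrite big_cons Pj.
by apply: poly_bound_ext IH => x; rewrite big_cons Pj.
Qed.

Lemma poly_boundX a r f M k :
  0 <= r -> poly_bound a r f M -> poly_bound a r (fun x => f x ^+ k) (M ^+ k).
Proof.
move=> r0 fM; elim: k => [|k IH].
  by rewrite expr0 -[X in poly_bound _ _ _ X]normr1 -cabs_real; exact: poly_bound_cst.
rewrite exprS; apply: poly_bound_ext (poly_boundM r0 fM IH) => x.
by rewrite exprS.
Qed.

Lemma poly_bound_cabs a r f M (x : {ffun I -> R[i]}) :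
  poly_bound a r f M -> (forall i, cabs (x i - a i) <= r) -> cabs (f x) <= M.
Proof.
move=> [s fs sM] xr; apply: le_trans sM; rewrite fs.
rewrite (le_trans (cabs_sum _ _ _))// ler_sum// => p _.
rewrite cabsM ler_wpM2l ?cabs_ge0// cabs_prod.
under eq_bigr do rewrite cabsX ffunE.
have /(monomial_le p.2)/andP[] // : forall i, 0 <= cabs (x i - a i) <= r.
by move=> i; rewrite cabs_ge0 xr.
Qed.

(** Each factor [x i - a i] is [(x i - b i) + (b i - a i)], of norm at most [(r - t) + t = r] at the
    new centre, so every monomial keeps its old weight as a bound. *)
Lemma poly_bound_recenter a b r t f M :
  0 <= t <= r -> (forall i, cabs (b i - a i) <= t) ->
  poly_bound a r f M -> poly_bound b (r - t) f M.
Proof.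
move=> /andP[t0 tr] bt [s fs sM]; have rt0 : 0 <= r - t by rewrite subr_ge0.
apply: (poly_bound_le sM); apply: poly_bound_ext (_ : poly_bound b _ _ _).
  by move=> x; rewrite fs /poly_eval; exact: erefl.
apply: poly_bound_sum => p _; apply: poly_boundM => //.
  exact: poly_bound_cst.
rewrite expr_sum; apply: poly_bound_prod => // i _; apply: poly_boundX => //.
rewrite -[X in poly_bound _ _ _ X](subrK t).
apply: poly_bound_ext (poly_boundD (poly_bound_coord _ _ i)
  (poly_bound_le (bt i) (poly_bound_cst _ _ (b i - a i)))) => x.
by rewrite ffunE addrA subrK.
Qed.

End PolyBound.

(** * Limits of polynomials as analytic functions *)

Lemma cvgC_le (R : realType) (x : nat -> (R[i] : numFieldType))
    (l : (R[i] : numFieldType)) :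
  (forall e : R, 0 < e -> exists N, forall n, (N <= n)%N -> cabs (l - x n) <= e) ->
  (x @ \oo --> l)%classic.
Proof.
move=> H; apply/cvgrPdist_le => e e0.
have eE : e = (complex.Re e)%:C%C by rewrite RRe_real ?gtr0_real.
have /H[N HN] : 0 < complex.Re e by rewrite -ltcR -eE.
by exists N => // n /= Nn; rewrite cabsE eE lecR HN.
Qed.

Lemma cvgn_nondecreasingC (R : realType) (x : nat -> R) (M : R) :
  {homo x : n m / (n <= m)%N >-> n <= m} -> (forall n, x n <= M) ->
  (cvgn (fun n => (x n)%:C%C : (R[i] : numFieldType)))%classic.
Proof.
move=> x_nd xM; have /cvg_ex[l xll] : (cvgn x)%classic.
  by apply: nondecreasing_is_cvgn => //; exists M => _ [n _ <-].
apply/cvg_ex; exists l%:C%C; apply: cvgC_le => e e0.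
have /cvgrPdist_le/(_ e e0)[N _ HN] := xll.
by exists N => n Nn; rewrite -rmorphB cabs_real HN.
Qed.

(* The Taylor coefficients of the limit are the limits of those of the
   polynomials f k; the summable bounds make the passage to the limit uniform
   in the degree of truncation. *)
Lemma analytic_at_within_lim (R : realType) (I : finType)
    (E : set {ffun I -> R[i]}) (f : nat -> {ffun I -> R[i]} -> R[i])
    (g : {ffun I -> R[i]} -> R[i]) (a : {ffun I -> R[i]}) (r M0 M M' : R) :
  0 < r -> poly_bound a r (f 0%N) M0 ->
  (forall k, poly_bound a r (fun x => f k.+1 x - f k x) (M * 2^-1 ^+ k)) ->
  (forall k (x : {ffun I -> R[i]}), (forall i, cabs (x i - a i) < r) ->
     cabs (g x - f k x) <= M' * 2^-1 ^+ k) ->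
  analytic_at_within E g a.
Proof.
move=> r0 f0M fM fg; have r0' := ltW r0.
have [s0 f0E s0M] := f0M.
have /choice[s Hs] k : exists s : seq (R[i] * {ffun I -> nat}),
    (forall x, f k.+1 x - f k x = poly_eval s [ffun i => x i - a i]) /\
    poly_norm r s <= M * 2^-1 ^+ k.
  by have [s ? ?] := fM k; exists s.
(* Concatenating increments represents every [f k] and makes [C k] an initial segment of
   [C (k + j)]; the coefficients then differ by those of the block [Tl k j]. *)
pose C := fix C k := if k is k'.+1 then C k' ++ s k' else s0.
have CE k x : f k x = poly_eval (C k) [ffun i => x i - a i].
  elim: k => [|k IH] /=; first exact: f0E.
  by rewrite poly_eval_cat -IH -(Hs k).1 addrC subrK.
pose Tl k := fix Tl j := if j is j'.+1 then Tl j' ++ s (k + j')%N else [::].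
have CTl k j m : poly_coef (C (k + j)%N) m = poly_coef (C k) m + poly_coef (Tl k j) m.
  elim: j => [|j IH]; first by rewrite addn0 /poly_coef big_nil addr0.
  by rewrite addnS /= !poly_coef_cat IH addrA.
have M_ge0 : 0 <= M.
  by have := poly_bound_ge0 r0' (fM 0%N); rewrite expr0 mulr1.
have half_ge0 k : 0 <= 2^-1 ^+ k :> R by rewrite exprn_ge0// invr_ge0.
have TlM k j : poly_norm r (Tl k j) <= 2 * M * 2^-1 ^+ k.
  suff: poly_norm r (Tl k j) <= 2 * M * 2^-1 ^+ k - 2 * M * 2^-1 ^+ (k + j).
    by have := mulr_ge0 M_ge0 (half_ge0 (k + j)%N); lra.
  elim: j => [|j IH]; first by rewrite addn0 subrr /poly_norm big_nil.
  rewrite /= poly_norm_cat addnS exprS.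
  by have := (Hs (k + j)%N).2; move: IH; set u := 2^-1 ^+ (k + j); lra.
(* An increment of norm at most [M * 2^-k] has a coefficient of modulus at most [M * 2^-k / r ^ |m|]
   at [m], so the coefficients at each [m] converge geometrically. *)
have /choice[c Hc] (m : {ffun I -> nat}) : exists cm : R[i], forall k,
    cabs (cm - poly_coef (C k) m)
      <= 4 * (M / r ^+ (\sum_i m i)%N) * 2^-1 ^+ k.
  apply: dyadic_limC => k.
  rewrite /= poly_coef_cat addrC addKr mulrAC.
  rewrite ler_pdivlMr ?exprn_gt0//; apply: le_trans (Hs k).2.
  rewrite /poly_norm (le_trans (ler_wpM2r (exprn_ge0 _ r0') (cabs_sum _ _ _)))//.
  rewrite mulr_suml big_mkcond /= ler_sum// => p _.
  case: eqP => [->//|_]; by rewrite mulr_ge0 ?cabs_ge0 ?exprn_ge0.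
have tailc (t : {ffun I -> R}) k n : (forall i, 0 <= t i <= r) ->
    \sum_(0 <= l < n) homogeneous_part (fun m => cabs (c m - poly_coef (C k) m)) t l
      <= 2 * M * 2^-1 ^+ k.
  move=> tr; have t0 i : 0 <= t i by case/andP: (tr i).
  pose b (m : {ffun I -> nat}) := M / r ^+ (\sum_i m i)%N.
  (* [B] depends on [n] and [t], but it comes with a power of [2^-1] that vanishes as [j] grows;
     what remains is the norm of [Tl k j], bounded uniformly in [n]. *)
  pose B := 4 * (\sum_(0 <= l < n) homogeneous_part b t l).
  apply: (@dyadic_le _ _ _ (B * 2^-1 ^+ k)) => j.
  apply: (@le_trans _ _ (\sum_(0 <= l < n)
     (homogeneous_part (cabs \o poly_coef (Tl k j)) t l +
      (4 * 2^-1 ^+ (k + j)) * homogeneous_part b t l))).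
    apply: ler_sum => l _.
    rewrite -homogeneous_partZ -homogeneous_partD.
    apply: homogeneous_part_le => // m.
    have := Hc m (k + j)%N; rewrite mulrAC => Hcm.
    apply: (le_trans _ (lerD (lexx _) Hcm)) => /=.
    rewrite [leRHS]addrC.
    apply: le_trans (cabsD _ _).
    by rewrite CTl opprD addrA subrK.
  rewrite big_split /= -mulr_sumr lerD//.
    exact: le_trans (poly_coef_norm _ _ tr) (TlM k j).
  by rewrite exprD /B le_eqVlt; apply/orP; left; apply/eqP; ring.
have cM (t : {ffun I -> R}) n : (forall i, 0 <= t i <= r) ->
    \sum_(0 <= l < n) homogeneous_part (cabs \o c) t l <= 2 * M + M0.
  move=> tr; have t0 i : 0 <= t i by case/andP: (tr i).
  apply: (@le_trans _ _ (\sum_(0 <= l < n)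
     (homogeneous_part (fun m => cabs (c m - poly_coef (C 0%N) m)) t l +
      homogeneous_part (cabs \o poly_coef s0) t l))).
    apply: ler_sum => l _; rewrite -homogeneous_partD.
    apply: homogeneous_part_le => // m /=.
    by apply: le_trans (cabsD _ _); rewrite subrK.
  rewrite big_split /= lerD//.
    by have := tailc t 0%N n tr; rewrite expr0 mulr1.
  by apply: le_trans s0M; exact: poly_coef_norm.
exists r%:C%C; first by rewrite ltcR.
exists c => x _ xr.
have xr' i : cabs (x i - a i) < r by rewrite -ltcR -cabsE; exact: xr.
pose h : {ffun I -> R[i]} := [ffun i => x i - a i].
have tr i : 0 <= [ffun i => cabs (h i)] i <= r.
  by rewrite !ffunE cabs_ge0 ltW.
split.
  have -> : [ffun i => `|x i - a i|] = [ffun i => `|h i|].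
    by apply/ffunP => i; rewrite !ffunE.
  pose y n :=
    \sum_(0 <= l < n) homogeneous_part (cabs \o c) [ffun i => cabs (h i)] l.
  have -> : series (homogeneous_part (fun m => `|c m|) [ffun i => `|h i|])
      = (fun n => (y n)%:C%C).
    apply/funext => n; rewrite /series /= /y rmorph_sum; apply: eq_bigr => l _.
    exact: homogeneous_part_norm.
  apply: (@cvgn_nondecreasingC _ _ (2 * M + M0)) => [m n mn|n]; last exact: cM.
  rewrite /y (big_cat_nat _ mn)//= lerDl sumr_ge0// => l _.
  apply: homogeneous_part_ge0 => [i|m']; first by case/andP: (tr i).
  exact: cabs_ge0.
apply: cvgC_le => e e0.
(* First [k] makes [f k] close to [g] and the remaining coefficients small; then [N] passes the
   degree of [C k], where the truncated sum for [C k] equals [f k]. *)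
have [k Hk] := dyadic_small (M' + 2 * M) e0.
have [N HN] := poly_eval_homogeneous (C k).
exists N => n Nn; rewrite /series /=.
rewrite -[X in cabs (g x - X)](subrK (f k x)) opprD addrA addrAC.
apply: (le_trans (cabsD _ _)); apply: le_trans Hk; rewrite mulrDl.
apply: lerD; first exact: fg.
rewrite cabsN CE -(HN _ _ Nn) -sumrB.
apply: le_trans (cabs_sum _ _ _) _.
apply: le_trans (tailc _ k n tr); apply: ler_sum => l _.
rewrite -homogeneous_partN -homogeneous_partD.
exact: cabs_homogeneous_part.
Qed.

(** * Analytic fixed points *)

(* The same delta serves all radii r <= delta: g need not be differentiable in
   the parameter x, only continuous, in the algebra norm of poly_bound. *)
Definition strict_diff (R : rcfType) (I : finType) (n : nat)
    (a : {ffun I -> R[i]}) (u : 'cV[R[i]]_n)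
    (g : {ffun I -> R[i]} -> 'cV[R[i]]_n -> R[i]) (L : 'I_n -> R[i]) : Prop :=
  forall e : R, 0 < e -> exists2 delta : R, 0 < delta &
    forall (r : R) (y : {ffun I -> R[i]} -> 'cV[R[i]]_n),
      0 <= r <= delta ->
      (forall j, poly_bound a r (fun x => y x j 0 - u j 0) delta) ->
      poly_bound a r (fun x => g x (y x) - g a u) e /\
      forall (y' : {ffun I -> R[i]} -> 'cV[R[i]]_n) (eta : R), 0 <= eta ->
        (forall j, poly_bound a r (fun x => y' x j 0 - u j 0) delta) ->
        (forall j, poly_bound a r (fun x => y x j 0 - y' x j 0) eta) ->
        poly_bound a r (fun x => g x (y x) - g x (y' x)
                                 - \sum_j L j * (y x j 0 - y' x j 0)) (e * eta).

Section StrictDiff.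
Variables (R : realType) (I : finType) (n : nat).
Variables (a : {ffun I -> R[i]}) (u : 'cV[R[i]]_n).
Implicit Types (g : {ffun I -> R[i]} -> 'cV[R[i]]_n -> R[i]) (L : 'I_n -> R[i]).

Lemma strict_diff_ext g g' L L' :
  g =2 g' -> L =1 L' -> strict_diff a u g L -> strict_diff a u g' L'.
Proof.
move=> gg' LL' gL e /gL[d d0 H]; exists d => // r y rd yd.
have [H1 H2] := H r y rd yd; split.
  by apply: poly_bound_ext H1 => x; rewrite !gg'.
move=> y' eta eta0 y'd yy'; apply: poly_bound_ext (H2 _ _ eta0 y'd yy') => x.
by rewrite !gg'; congr (_ - _); apply: eq_bigr => j _; rewrite LL'.
Qed.

Lemma strict_diff_cst c : strict_diff a u (fun _ _ => c) (fun=> 0).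
Proof.
move=> e e0; exists 1 => // r y /andP[r0 _] _; split.
  apply: poly_bound_ext (poly_bound_le (ltW e0) (poly_bound0 _ _)) => x.
  by rewrite subrr.
move=> y' eta eta0 _ _.
apply: poly_bound_ext (poly_bound_le _ (poly_bound0 _ _)) => [x|].
  by rewrite subrr sub0r big1 ?oppr0// => j _; rewrite mul0r.
by rewrite mulr_ge0// ltW.
Qed.

Lemma strict_diff_param i : strict_diff a u (fun x _ => x i) (fun=> 0).
Proof.
move=> e e0; exists e => // r y /andP[r0 re] _; split.
  exact: poly_bound_le re (poly_bound_coord _ _ _).
move=> y' eta eta0 _ _.
apply: poly_bound_ext (poly_bound_le _ (poly_bound0 _ _)) => [x|].
  by rewrite subrr sub0r big1 ?oppr0// => j _; rewrite mul0r.
by rewrite mulr_ge0// ltW.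
Qed.

Lemma strict_diff_var k :
  strict_diff a u (fun _ y => y k 0) (fun j => (j == k)%:R).
Proof.
move=> e e0; exists e => // r y /andP[r0 re] yd; split; first exact: yd.
move=> y' eta eta0 _ _.
apply: poly_bound_ext (poly_bound_le _ (poly_bound0 _ _)) => [x|].
  rewrite (bigD1 k)//= eqxx mul1r big1 ?addr0 ?subrr// => j /negPf ->.
  by rewrite mul0r.
by rewrite mulr_ge0// ltW.
Qed.

Lemma strict_diffD g g' L L' :
  strict_diff a u g L -> strict_diff a u g' L' ->
  strict_diff a u (fun x y => g x y + g' x y) (fun j => L j + L' j).
Proof.
move=> gL gL' e e0; have e2 : 0 < e / 2 by rewrite divr_gt0.
have [d d0 H] := gL _ e2; have [d' d'0 H'] := gL' _ e2.
have dmin : Num.min d d' <= d by rewrite ge_min lexx.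
have dmin' : Num.min d d' <= d' by rewrite ge_min lexx orbT.
exists (Num.min d d'); first by rewrite lt_min d0.
move=> r y /andP[r0 rd] yd.
have [|j|B1 B2] := H r y; first by rewrite r0 (le_trans rd).
  exact: poly_bound_le (yd j).
have [|j|B1' B2'] := H' r y; first by rewrite r0 (le_trans rd).
  exact: poly_bound_le (yd j).
rewrite [e](_ : _ = e / 2 + e / 2); last by field.
split.
  by apply: poly_bound_ext (poly_boundD B1 B1') => x; ring.
move=> y' eta eta0 y'd yy'; rewrite mulrDl.
have {}B2 := B2 y' eta eta0 (fun j => poly_bound_le dmin (y'd j)) yy'.
have {}B2' := B2' y' eta eta0 (fun j => poly_bound_le dmin' (y'd j)) yy'.
apply: poly_bound_ext (poly_boundD B2 B2') => x.
rewrite [in RHS](eq_bigr (fun j => L j * (y x j 0 - y' x j 0)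
  + L' j * (y x j 0 - y' x j 0))); last by move=> j _; rewrite /= mulrDl.
by rewrite big_split /=; ring.
Qed.

Lemma strict_diffM g g' L L' :
  strict_diff a u g L -> strict_diff a u g' L' ->
  strict_diff a u (fun x y => g x y * g' x y)
    (fun j => L j * g' a u + g a u * L' j).
Proof.
move=> gL gL' e e0.
pose K := \sum_j cabs (L j); pose K' := \sum_j cabs (L' j).
have K0 : 0 <= K by apply: sumr_ge0 => j _; exact: cabs_ge0.
have K'0 : 0 <= K' by apply: sumr_ge0 => j _; exact: cabs_ge0.
pose c := cabs (g a u); pose c' := cabs (g' a u).
have c0 : 0 <= c by exact: cabs_ge0.
have c'0 : 0 <= c' by exact: cabs_ge0.
(* [B] collects the factors of [e1] in both estimates; [e1 <= 1] bounds the squares of [e1] by [e1],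
   whence the summand 2. *)
pose B := c + c' + K + K' + 2.
have B0 : 0 < B by rewrite /B; lra.
pose e1 := Num.min 1 (e / B).
have e10 : 0 < e1 by rewrite lt_min ltr01 divr_gt0.
have e11 : e1 <= 1 by rewrite ge_min lexx.
have e1B : e1 * B <= e by rewrite -ler_pdivlMr// ge_min lexx orbT.
have [d d0 H] := gL _ e10; have [d' d'0 H'] := gL' _ e10.
have dmin : Num.min d d' <= d by rewrite ge_min lexx.
have dmin' : Num.min d d' <= d' by rewrite ge_min lexx orbT.
exists (Num.min d d'); first by rewrite lt_min d0.
move=> r y /andP[r0 rd] yd.
have rd1 : 0 <= r <= d by rewrite r0 (le_trans rd).
have rd1' : 0 <= r <= d' by rewrite r0 (le_trans rd).
have [B1 B2] := H r y rd1 (fun j => poly_bound_le dmin (yd j)).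
have [B1' B2'] := H' r y rd1' (fun j => poly_bound_le dmin' (yd j)).
have cst x : poly_bound a r (fun=> x) (cabs x) by exact: poly_bound_cst.
split.
  apply: (@poly_bound_le _ _ _ _ _ (e1 * e1 + c * e1 + e1 * c')).
    by apply: le_trans e1B; rewrite /B; nra.
  apply: poly_bound_ext (poly_boundD (poly_boundD (poly_boundM r0 B1 B1')
    (poly_boundM r0 (cst (g a u)) B1')) (poly_boundM r0 B1 (cst (g' a u)))) => x.
  by ring.
move=> y' eta eta0 y'd yy'.
have {}B2 := B2 y' eta eta0 (fun j => poly_bound_le dmin (y'd j)) yy'.
have {}B2' := B2' y' eta eta0 (fun j => poly_bound_le dmin' (y'd j)) yy'.
have [B3 _] := H r y' rd1 (fun j => poly_bound_le dmin (y'd j)).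
have linear (l : 'I_n -> R[i]) : poly_bound a r
    (fun x => \sum_j l j * (y x j 0 - y' x j 0)) ((\sum_j cabs (l j)) * eta).
  rewrite mulr_suml; apply: poly_bound_sum => j _; exact: poly_boundZ.
(* The error of the product rule has four pieces: the remainder of [g] times [g'] at [y], the
   [L]-part times the variation of [g'], [g] at [y'] times the remainder of [g'], and the variation
   of [g] times the [L']-part. *)
have B4 := poly_boundD (poly_boundD (poly_boundD
  (poly_boundM r0 B2 (poly_boundD B1' (cst (g' a u))))
  (poly_boundM r0 (linear L) B1'))
  (poly_boundM r0 (poly_boundD B3 (cst (g a u))) B2'))
  (poly_boundM r0 B3 (linear L')).
apply: (poly_bound_le _ (poly_bound_ext _ B4)).
  rewrite -/K -/K' -/c -/c'.
  apply: (@le_trans _ _ (e1 * B * eta)); last exact: ler_wpM2r.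
  rewrite /B; suff: e1 * e1 * eta <= e1 * eta by nra.
  by rewrite ler_wpM2r// ler_piMr// ltW.
move=> x.
rewrite [in RHS](eq_bigr (fun j => g' a u * (L j * (y x j 0 - y' x j 0))
  + g a u * (L' j * (y x j 0 - y' x j 0)))); last by move=> j _; ring.
by rewrite big_split /= -!mulr_sumr; ring.
Qed.

Lemma strict_diffN g L :
  strict_diff a u g L -> strict_diff a u (fun x y => - g x y) (fun j => - L j).
Proof.
move=> /(strict_diffM (strict_diff_cst (-1))); apply: strict_diff_ext => [x y|j].
  by rewrite mulN1r.
by rewrite mul0r add0r mulN1r.
Qed.

Lemma strict_diff_sum (J : Type) (s : seq J) (P : pred J) F (D : J -> 'I_n -> R[i]) :
  (forall j, P j -> strict_diff a u (F j) (D j)) ->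
  strict_diff a u (fun x y => \sum_(j <- s | P j) F j x y)
    (fun k => \sum_(j <- s | P j) D j k).
Proof.
move=> FD; elim: s => [|j s IH].
  by apply: strict_diff_ext (strict_diff_cst 0) => [x y|j]; rewrite big_nil.
have [Pj|/negPf Pj] := boolP (P j).
  by apply: strict_diff_ext (strict_diffD (FD j Pj) IH) => [x y|k];
    rewrite big_cons Pj.
by apply: strict_diff_ext IH => [x y|k]; rewrite big_cons Pj.
Qed.

Lemma strict_diffX g L k :
  strict_diff a u g L ->
  strict_diff a u (fun x y => g x y ^+ k)
    (fun j => k%:R * g a u ^+ k.-1 * L j).
Proof.
move=> gL; elim: k => [|k IH].
  apply: strict_diff_ext (strict_diff_cst 1) => [x y|j]; first by rewrite expr0.
  by rewrite !mul0r.
apply: strict_diff_ext (strict_diffM gL IH) => [x y|j]; first by rewrite exprS.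
rewrite /= -natr1; case: k {IH} => [|k] /=; first by rewrite expr0; ring.
by rewrite exprS; ring.
Qed.

End StrictDiff.

Lemma min_pos_family (R : realType) (J : finType) (P : J -> R -> Prop) :
  (forall j d d', 0 < d' <= d -> P j d -> P j d') ->
  (forall j, exists2 d, 0 < d & P j d) ->
  exists2 d, 0 < d & forall j, P j d.
Proof.
move=> Pmon Pex; have /choice[d Hd] j : exists d, 0 < d /\ P j d.
  by have [d ? ?] := Pex j; exists d.
(* The default 1 keeps the minimum positive when [J] is empty. *)
exists (\big[Num.min/1]_j d j) => [|j].
  by apply: lt_bigmin => // j _; have [] := Hd j.
apply: Pmon (Hd j).2; rewrite bigmin_le_cond// andbT.
by apply: lt_bigmin => // i _; have [] := Hd i.
Qed.

(** A vanishing derivative in [y] makes [Phi] a contraction of factor 1/2 in the polynomial norm, so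
    the Picard iterates from the constant [u] have geometrically small increments. Uniqueness in the
    closed ball of radius [delta] is what later shows that the solution is real at real
    parameters. *)
Lemma fixed_point_analytic (R : realType) (I : finType) (n : nat)
    (a : {ffun I -> R[i]}) (u : 'cV[R[i]]_n)
    (Phi : {ffun I -> R[i]} -> 'cV[R[i]]_n -> 'cV[R[i]]_n) (e : R) :
  (forall i, strict_diff a u (fun x y => Phi x y i 0) (fun=> 0)) ->
  Phi a u = u -> 0 < e ->
  exists (z : {ffun I -> R[i]} -> 'cV[R[i]]_n) (delta r : R),
    [/\ 0 < r, 0 < delta <= e, z a = u &
      forall x : {ffun I -> R[i]}, (forall i, cabs (x i - a i) < r) ->
      [/\ forall c (l : 'I_n -> R[i]) E,
            analytic_at_within E (fun x => c + \sum_j l j * z x j 0) x,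
          Phi x (z x) = z x,
          forall i, cabs (z x i 0 - u i 0) <= delta
        & forall y : 'cV[R[i]]_n, (forall i, cabs (y i 0 - u i 0) <= delta) ->
            Phi x y = y -> y = z x]].
Proof.
move=> PhiD Phiu e0.
have half_ge0 k : 0 <= 2^-1 ^+ k :> R by rewrite exprn_ge0// invr_ge0.
have [d0 d0_gt0 contr] : exists2 d : R, 0 < d & forall i r
    (y y' : {ffun I -> R[i]} -> 'cV[R[i]]_n) (eta : R),
    0 <= r <= d -> 0 <= eta ->
    (forall j, poly_bound a r (fun x => y x j 0 - u j 0) d) ->
    (forall j, poly_bound a r (fun x => y' x j 0 - u j 0) d) ->
    (forall j, poly_bound a r (fun x => y x j 0 - y' x j 0) eta) ->
    poly_bound a r (fun x => Phi x (y x) i 0 - Phi x (y' x) i 0) (2^-1 * eta).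
  apply: min_pos_family => [i d d' /andP[d'0 d'd] H r y y' eta|i].
    move=> /andP[r0 rd'] eta0 yd y'd yy'; apply: H yy' => //.
    - by rewrite r0 (le_trans rd').
    - by move=> j; apply: poly_bound_le (yd j).
    - by move=> j; apply: poly_bound_le (y'd j).
  have half0 : 0 < 2^-1 :> R by rewrite invr_gt0.
  have [d d0 H] := PhiD i _ half0; exists d => // r y y' eta rd eta0 yd y'd yy'.
  have [_ H2] := H r y rd yd.
  apply: poly_bound_ext (H2 y' eta eta0 y'd yy') => x.
  by rewrite big1 ?subr0// => j _; rewrite mul0r.
pose d := Num.min d0 e; have d_gt0 : 0 < d by rewrite lt_min d0_gt0.
have dd0 : d <= d0 by rewrite ge_min lexx.
(* A first step of norm at most [d / 2], halved at each iteration, keeps all iterates within [d] of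
   [u]. *)
have [d' d'0 self] : exists2 d' : R, 0 < d' & forall i r, 0 <= r <= d' ->
    poly_bound a r (fun x => Phi x u i 0 - u i 0) (d / 2).
  apply: min_pos_family => [i s s' /andP[s'0 s's] H r /andP[r0 rs]|i].
    by apply: H; rewrite r0 (le_trans rs).
  have d2 : 0 < d / 2 by rewrite divr_gt0.
  have [s s0 H] := PhiD i _ d2; exists s => // r rs.
  have [|+ _] := H r (fun=> u) rs; last by rewrite Phiu.
  move=> j; apply: poly_bound_ext (poly_bound_le (ltW s0) (poly_bound0 _ _)) => x.
  by rewrite subrr.
pose r := Num.min d0 d'; have r_gt0 : 0 < r by rewrite lt_min d0_gt0.
have r_ge0 := ltW r_gt0.
have rd0 : 0 <= r <= d0 by rewrite r_ge0 ge_min lexx.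
have rd' : 0 <= r <= d' by rewrite r_ge0 ge_min lexx orbT.
pose Z := fix Z k := if k is k'.+1 then fun x => Phi x (Z k' x) else fun=> u.
have ZP k : (forall j, poly_bound a r (fun x => Z k x j 0 - u j 0)
                         (d - d * 2^-1 ^+ k)) /\
    (forall j, poly_bound a r (fun x => Z k.+1 x j 0 - Z k x j 0)
                         (d / 2 * 2^-1 ^+ k)).
  elim: k => [|k [IH1 IH2]].
    rewrite expr0 !mulr1 subrr; split => j; last exact: self.
    by apply: poly_bound_ext (poly_bound0 _ _) => x; rewrite subrr.
  have IH3 j : poly_bound a r (fun x => Z k.+1 x j 0 - u j 0)
      (d - d * 2^-1 ^+ k.+1).
    rewrite (_ : d - _ = d / 2 * 2^-1 ^+ k + (d - d * 2^-1 ^+ k)); last first.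
      by rewrite exprS; field.
    by apply: poly_bound_ext (poly_boundD (IH2 j) (IH1 j)) => x; rewrite addrA subrK.
  split => // j; rewrite exprS mulrCA; apply: contr => //.
  - by rewrite mulr_ge0// divr_ge0// ltW.
  - move=> i; apply: poly_bound_le (IH3 i).
    by have := mulr_ge0 (ltW d_gt0) (half_ge0 k.+1); lra.
  - move=> i; apply: poly_bound_le (IH1 i).
    by have := mulr_ge0 (ltW d_gt0) (half_ge0 k); lra.
(* Applied to constant polynomials, the contraction in norm becomes a pointwise one. *)
have contr1 (x : {ffun I -> R[i]}) (y y' : 'cV[R[i]]_n) eta i :
    (forall i, cabs (x i - a i) < r) -> 0 <= eta ->
    (forall j, cabs (y j 0 - u j 0) <= d) ->
    (forall j, cabs (y' j 0 - u j 0) <= d) ->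
    (forall j, cabs (y j 0 - y' j 0) <= eta) ->
    cabs (Phi x y i 0 - Phi x y' i 0) <= 2^-1 * eta.
  move=> xr eta0 yd y'd yy'.
  apply: (@poly_bound_cabs _ _ a r (fun x => Phi x y i 0 - Phi x y' i 0));
    last by move=> j; exact: ltW.
  apply: (contr i r (fun=> y) (fun=> y')) => // j.
  - exact: poly_bound_le (le_trans (yd j) dd0) (poly_bound_cst _ _ _).
  - exact: poly_bound_le (le_trans (y'd j) dd0) (poly_bound_cst _ _ _).
  - exact: poly_bound_le (yy' j) (poly_bound_cst _ _ _).
have /choice[z Hz] (x : {ffun I -> R[i]}) : exists zx : 'cV[R[i]]_n,
    (forall i, cabs (x i - a i) < r) ->
    forall k i, cabs (zx i 0 - Z k x i 0) <= 4 * (d / 2) * 2^-1 ^+ k.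
  (* Outside the polydisc the value 0 is a placeholder. *)
  have [xr|] := pselect (forall i, cabs (x i - a i) < r); last by exists 0.
  have /choice[zx Hzx] (i : 'I_n) : exists l, forall k,
      cabs (l - Z k x i 0) <= 4 * (d / 2) * 2^-1 ^+ k.
    apply: (@dyadic_limC _ (fun k => Z k x i 0)) => k.
    apply: poly_bound_cabs ((ZP k).2 i) _ => j; exact: ltW.
  by exists (\col_i zx i) => _ k i; rewrite mxE.
have uniq (x : {ffun I -> R[i]}) (y y' : 'cV[R[i]]_n) :
    (forall i, cabs (x i - a i) < r) ->
    (forall j, cabs (y j 0 - u j 0) <= d) ->
    (forall j, cabs (y' j 0 - u j 0) <= d) -> Phi x y = y -> Phi x y' = y' ->
    y = y'.
  move=> xr yd y'd yE y'E.
  (* Two points within [d] of [u] are at most [2 * d] apart, and each application of [Phi] halves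
     the bound. *)
  have yy' k : forall i, cabs (y i 0 - y' i 0) <= 2 * d * 2^-1 ^+ k.
    elim: k => [|k IH] i.
      rewrite expr0 mulr1; apply: le_trans (cabs_distD (u i 0) _ _) _.
      rewrite [X in _ + X]cabsB.
      by have := yd i; have := y'd i; lra.
    rewrite -yE -y'E exprS mulrCA; apply: contr1 => //.
    by rewrite !mulr_ge0// ltW.
  apply/matrixP => i j; rewrite ord1; apply/eqP; rewrite -subr_eq0 -cabs_eq0.
  rewrite eq_le cabs_ge0 andbT.
  by apply: (@dyadic_le _ _ _ (2 * d)) => k; rewrite add0r.
have zd (x : {ffun I -> R[i]}) :
    (forall i, cabs (x i - a i) < r) -> forall i, cabs (z x i 0 - u i 0) <= d.
  move=> xr i; apply: (@dyadic_le _ _ _ (4 * (d / 2))) => k.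
  apply: le_trans (cabs_distD (Z k x i 0) _ _) _.
  rewrite addrC; apply: lerD; last exact: Hz.
  have xr' j : cabs (x j - a j) <= r by exact: ltW.
  apply: le_trans (poly_bound_cabs ((ZP k).1 i) xr') _.
  by have := mulr_ge0 (ltW d_gt0) (half_ge0 k); lra.
have zE (x : {ffun I -> R[i]}) :
    (forall i, cabs (x i - a i) < r) -> Phi x (z x) = z x.
  move=> xr; apply/matrixP => i j; rewrite ord1.
  apply/eqP; rewrite -subr_eq0 -cabs_eq0 eq_le cabs_ge0 andbT.
  apply: (@dyadic_le _ _ _ (2 * d)) => k; rewrite add0r.
  (* The intermediate point is [Z k.+1 x]: it is close to [Phi x (z x)] by contraction and to [z x]
     by convergence. *)
  apply: le_trans (cabs_distD (Phi x (Z k x) i 0) _ _) _.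
  have h1 : cabs (Phi x (z x) i 0 - Phi x (Z k x) i 0)
      <= 2^-1 * (4 * (d / 2) * 2^-1 ^+ k).
    apply: contr1 => //; [|exact: zd| |exact: Hz].
      by have := mulr_ge0 (ltW d_gt0) (half_ge0 k); lra.
    move=> l; have xr' m : cabs (x m - a m) <= r by exact: ltW.
    apply: le_trans (poly_bound_cabs ((ZP k).1 l) xr') _.
    by have := mulr_ge0 (ltW d_gt0) (half_ge0 k); lra.
  have h2 := Hz x xr k.+1 i; rewrite exprS in h2.
  rewrite [X in _ + X]cabsB.
  rewrite -[Phi x (Z k x)]/(Z k.+1 x).
  by move: h1 h2; set w := 2^-1 ^+ k; lra.
have ar i : cabs (a i - a i) < r by rewrite subrr cabs0.
exists z, d, r; split => //.
- by rewrite d_gt0 ge_min lexx orbT.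
- apply/esym/(@uniq a) => //; [|exact: zd|exact: zE].
  by move=> j; rewrite subrr cabs0 ltW.
- move=> x xr; split; [|exact: zE|exact: zd|].
    move=> c l E.
    (* [t] is the distance from the centre [a] to [x]; as [t < r], all bounds can be recentred at
       [x] with the positive radius [r - t]. *)
    pose t := \big[Num.max/0]_j cabs (x j - a j).
    have tr : t < r by apply: bigmax_lt.
    have t0 : 0 <= t by exact: bigmax_ge_id.
    have xt j : cabs (x j - a j) <= t by apply: le_bigmax_cond.
    have rc f M : poly_bound a r f M -> poly_bound x (r - t) f M.
      by apply: poly_bound_recenter => //; rewrite t0 ltW.
    have cst y : poly_bound x (r - t) (fun=> y) (cabs y).
      exact: poly_bound_cst.
    have rt0 : 0 <= r - t by rewrite subr_ge0 ltW.
    pose K := \sum_j cabs (l j).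
    apply: (@analytic_at_within_lim _ _ _
      (fun k x => c + \sum_j l j * Z k x j 0) _ _ (r - t)
      (cabs c + \sum_j cabs (l j) * cabs (u j 0)) (K * (d / 2))
      (K * (4 * (d / 2)))).
    + by rewrite subr_gt0.
    + apply: poly_boundD; first exact: cst.
      apply: poly_bound_sum => j _.
      exact: poly_boundM rt0 (cst _) (cst _).
    + move=> k; rewrite -mulrA /K mulr_suml.
      apply: (@poly_bound_ext _ _ _ _
        (fun y => \sum_j l j * (Z k.+1 y j 0 - Z k y j 0))) => [y|]; last first.
        apply: poly_bound_sum => j _.
        exact: poly_boundZ rt0 (rc _ _ ((ZP k).2 j)).
      rewrite opprD addrACA subrr add0r -sumrB.
      by apply: eq_bigr => j _; rewrite mulrBr.
    + move=> k x' x'x; rewrite opprD addrACA subrr add0r -sumrB.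
      rewrite -mulrA /K mulr_suml.
      apply: le_trans (cabs_sum _ _ _) _; apply: ler_sum => j _.
      rewrite -mulrBr cabsM ler_wpM2l ?cabs_ge0//; apply: Hz => i.
      apply: le_lt_trans (cabs_distD (x i) _ _) _.
      by have := x'x i; have := xt i; lra.
  by move=> y yd yE; apply: (@uniq x) => //; [exact: zd|exact: zE].
Qed.

(** * Tensors and the Collatz-Wielandt inequality *)

Lemma tensor_app_map (K K' : pzRingType) (f : {rmorphism K -> K'}) (n d : nat)
    (T : tensor K n d) (x : 'cV[K]_n) :
  tensor_app [ffun J => f (T J)] (map_mx f x) = map_mx f (tensor_app T x).
Proof.
apply/matrixP => i j; rewrite !mxE rmorph_sum; apply: eq_bigr => J _.
rewrite ffunE rmorphM rmorph_prod; congr (_ * _).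
by apply: eq_bigr => k _; rewrite mxE.
Qed.

Lemma hadamard_exp_map (K K' : pzRingType) (f : {rmorphism K -> K'}) (n : nat)
    (x : 'cV[K]_n) p :
  hadamard_exp (map_mx f x) p = map_mx f (hadamard_exp x p).
Proof. by apply/matrixP => i j; rewrite !mxE rmorphXn. Qed.

Lemma tensor_app_le (R : numDomainType) (n d : nat) (T : tensor R n d)
    (x y : 'cV[R]_n) i :
  nonneg_tensor T -> (forall k, 0 <= x k 0 <= y k 0) ->
  tensor_app T x i 0 <= tensor_app T y i 0.
Proof.
move=> T0 xy; rewrite !mxE ler_sum// => J _.
by rewrite ler_wpM2l// ler_prod.
Qed.

Lemma prodr_const_seq (K : comPzRingType) (J : Type) (s : seq J) (t : K) :
  \prod_(k <- s) t = t ^+ size s.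
Proof. by rewrite big_const_seq count_predT iter_mulr_1. Qed.

Lemma tensor_appZ (K : comPzRingType) (n d : nat) (T : tensor K n d) t
    (x : 'cV[K]_n) :
  tensor_app T (t *: x) = t ^+ (d - 1) *: tensor_app T x.
Proof.
apply/matrixP => i j; rewrite !mxE mulr_sumr; apply: eq_bigr => J _.
rewrite mulrCA; congr (_ * _).
under eq_bigr do rewrite mxE.
by rewrite big_split /= prodr_const_seq size_drop size_tuple.
Qed.

(** Let [t] be the largest ratio [x j / y j], attained at [k]. Then [x <= t y] with equality at [k],
    and monotonicity and homogeneity of the tensor map give l x_k^(d-1) <= T(x)_k <= t^(d-1) T(y)_k
    <= m x_k^(d-1). *)
Lemma collatz_wielandt_le (R : realFieldType) (n d : nat) (T : tensor R n d)
    (x y : 'cV[R]_n) (l m : R) :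
  nonneg_tensor T -> (forall i, 0 <= x i 0) -> x != 0 -> positive_vec y ->
  (forall i, l * x i 0 ^+ (d - 1) <= tensor_app T x i 0) ->
  (forall i, tensor_app T y i 0 <= m * y i 0 ^+ (d - 1)) ->
  l <= m.
Proof.
move=> T0 x0 xN0 y0 lx my.
have [i xi0] : exists i, 0 < x i 0.
  apply/not_existsP => H; move/eqP: xN0; apply.
  apply/matrixP => i j; rewrite ord1 mxE; apply/eqP.
  by rewrite eq_le x0 andbT leNgt; apply/negP/H.
have [k _ kmax] := @arg_maxP _ _ _ i xpredT (fun j => x j 0 / y j 0) erefl.
set t := x k 0 / y k 0 in kmax.
have t0 : 0 < t by apply: lt_le_trans (kmax i erefl); rewrite divr_gt0.
have tE : x k 0 = t * y k 0 by rewrite divfK// gt_eqF.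
have le1 : tensor_app T x k 0 <= tensor_app T (t *: y) k 0.
  by apply: tensor_app_le => // j; rewrite x0/= mxE -ler_pdivrMr//; exact: kmax.
rewrite tensor_appZ [leRHS]mxE in le1.
have := le_trans (lx k) le1; rewrite tE => /le_trans/(_ (ler_wpM2l _ (my k))).
move=> /(_ (exprn_ge0 _ (ltW t0))).
rewrite exprMn mulrCA ler_pM2l ?exprn_gt0// ler_pM2r//.
by rewrite exprn_gt0.
Qed.

(** By the triangle inequality the entrywise modulus [a] of an eigenvector for [lam] satisfies |lam|
    a^(d-1) <= T(a). Comparison with the positive [x] yields |lam| <= l, and [l] is itself an
    eigenvalue. *)
Lemma spectral_radius_positive (R : realType) (n d : nat) (T : tensor R n d)
    (x : 'cV[R]_n) (l : R) :
  (1 <= n)%N -> nonneg_tensor T -> positive_vec x ->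
  tensor_app T x = l *: hadamard_exp x (d - 1) -> spectral_radius T = l.
Proof.
move=> n1 T0 x0 Tx.
have TxE i : tensor_app T x i 0 = l * x i 0 ^+ (d - 1).
  by rewrite Tx !mxE.
have l0 : 0 <= l.
  rewrite -(@pmulr_lge0 _ (x (Ordinal n1) 0 ^+ (d - 1))) ?exprn_gt0// -TxE.
  rewrite mxE sumr_ge0// => J _; rewrite mulr_ge0// prodr_ge0// => k _.
  exact: ltW.
have lP : [set r | eigenvalue_moduli T r /\ ubound (eigenvalue_moduli T) r]%classic l.
  split.
    exists l%:C%C; last by rewrite cabsE cabs_real ger0_norm.
    exists (map_mx (real_complex R) x).
      apply/eqP => /matrixP/(_ (Ordinal n1) 0); rewrite !mxE => /complexI xE.
      by have := x0 (Ordinal n1); rewrite xE ltxx.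
    rewrite /complexify (tensor_app_map (real_complex R)) hadamard_exp_map Tx.
    by rewrite map_mxZ.
  move=> r [lam [z zN0 zE] lamr].
  pose a : 'cV[R]_n := \col_i cabs (z i 0).
  have a0 i : 0 <= a i 0 by rewrite mxE cabs_ge0.
  apply: (@collatz_wielandt_le _ _ _ T a x) => // [|i|i]; last by rewrite TxE.
    apply: contra zN0 => /eqP/matrixP aE; apply/eqP/matrixP => i j.
    by rewrite ord1; apply/eqP; have := aE i 0; rewrite !mxE -cabs_eq0 => ->.
  have -> : r * a i 0 ^+ (d - 1) = cabs (tensor_app (complexify T) z i 0).
    rewrite zE !mxE cabsM cabsX; congr (_ * _).
    by apply: complexI; rewrite -lamr cabsE.
  rewrite !mxE (le_trans (cabs_sum _ _ _))// ler_sum// => J _.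
  rewrite cabsM cabs_prod ffunE cabs_real ger0_norm//.
  rewrite [in leRHS](eq_bigr (fun k => cabs (z k 0)))// => k _.
  by rewrite mxE.
apply: xget_unique => // r [r1 r2]; case: lP => l1 l2.
by apply/eqP; rewrite eq_le l2// r2.
Qed.

(** * Directional derivatives of monomials, by the product rule, and of the tensor map *)

Fixpoint prod_deriv (K : pzRingType) (n : nat) (u h : 'I_n -> K)
    (s : seq 'I_n) : K :=
  if s is k :: s' then h k * \prod_(l <- s') u l + u k * prod_deriv u h s'
  else 0.

Lemma prod_deriv_id (K : comPzRingType) (n : nat) (u : 'I_n -> K) s :
  prod_deriv u u s = (size s)%:R * \prod_(l <- s) u l.
Proof.
elim: s => [|k s IH] /=; first by rewrite mul0r.
by rewrite IH big_cons -natr1; ring.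
Qed.

Lemma prod_deriv_ge0 (R : numDomainType) (n : nat) (u h : 'I_n -> R) s :
  (forall k, 0 <= u k) -> (forall k, 0 <= h k) -> 0 <= prod_deriv u h s.
Proof.
move=> u0 h0; elim: s => //= k s IH.
by rewrite addr_ge0// mulr_ge0// prodr_ge0.
Qed.

Lemma prod_deriv_gt0 (R : numDomainType) (n : nat) (u h : 'I_n -> R) s j :
  (forall k, 0 < u k) -> (forall k, 0 <= h k) -> 0 < h j -> j \in s ->
  0 < prod_deriv u h s.
Proof.
move=> u0 h0 hj; have u0' k : 0 <= u k by exact: ltW.
elim: s => //= k s IH; rewrite inE => /orP[/eqP <-|js].
  by rewrite ltr_wpDr ?mulr_gt0 ?prodr_gt0 ?mulr_ge0// prod_deriv_ge0.
by rewrite ltr_wpDl ?mulr_ge0 ?prodr_ge0// mulr_gt0 ?IH.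
Qed.

(** The factor that is differentiated is rotated to the front, where the symmetry of a tensor in its
    last indices can act on it. *)
Lemma prod_deriv_rot (K : comPzRingType) (n : nat) (u h : 'I_n -> K) s :
  prod_deriv u h s = \sum_(p < size s)
    (if rot p s is k :: s' then h k * \prod_(l <- s') u l else 0).
Proof.
elim: s => [|k s IH]; first by rewrite big_ord0.
rewrite /= big_ord_recl rot0; congr (_ + _).
rewrite IH mulr_sumr; apply: eq_bigr => p _ /=.
rewrite /rot /= (drop_nth k)//= !big_cat big_cons /=.
by ring.
Qed.

(** Rotating the tail permutes the multi-indices with first entry [i], and [T] is invariant under
    it. *)
Lemma perm_tail_sum (K : comPzRingType) (n d : nat) (T : tensor K n d.+1)
    (i : 'I_n) (F : seq 'I_n -> K) p :
  partially_symmetric T ->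
  \sum_(J : d.+1.-tuple 'I_n | take 1 J == [:: i]) T J * F (rot p (drop 1 J)) =
  \sum_(J : d.+1.-tuple 'I_n | take 1 J == [:: i]) T J * F (drop 1 J).
Proof.
move=> Tps.
pose sg q (J : d.+1.-tuple 'I_n) : d.+1.-tuple 'I_n :=
  [tuple of thead J :: rot q (behead_tuple J)].
pose sg' q (J : d.+1.-tuple 'I_n) : d.+1.-tuple 'I_n :=
  [tuple of thead J :: rotr q (behead_tuple J)].
have sgK : cancel (sg p) (sg' p).
  by move=> I; case/tupleP: I => x J; apply: val_inj; rewrite /= theadE rotK.
have sgK' : cancel (sg' p) (sg p).
  by move=> I; case/tupleP: I => x J; apply: val_inj; rewrite /= theadE rotrK.
rewrite [RHS](reindex (sg p)) /=; last by exists (sg' p) => J _.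
apply: eq_big => [J|J _].
  by case/tupleP: J => x J; rewrite /= theadE !take0.
rewrite (_ : T (sg p J) = T J); last first.
  case/tupleP: J => x J; apply: Tps; first by rewrite /= theadE !take0.
  by rewrite /= !drop0 perm_rot.
by case/tupleP: J => x J /=; rewrite !drop0.
Qed.

(** By symmetry the [d - 1] positions of the tail contribute equally, which is the factor in
    [tensor_deriv]; thus that matrix is the true derivative of the tensor map. *)
Lemma tensor_deriv_mul (K : comPzRingType) (n d : nat) (T : tensor K n d)
    (u : 'cV[K]_n) (h : 'I_n -> K) (i : 'I_n) :
  (2 <= d)%N -> partially_symmetric T ->
  \sum_(J : d.-tuple 'I_n | take 1 J == [:: i])
     T J * prod_deriv (u ^~ 0) h (drop 1 J) =
  \sum_j tensor_deriv T u i j * h j.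
Proof.
case: d T => [//|[//|d]] T _ Tps.
pose F (s : seq 'I_n) := if s is k :: s' then h k * \prod_(l <- s') u l 0 else 0.
transitivity (\sum_(p < d.+1) \sum_(J : d.+2.-tuple 'I_n | take 1 J == [:: i])
    T J * F (rot p (drop 1 J))).
  rewrite exchange_big /=; apply: eq_bigr => J _.
  by rewrite prod_deriv_rot size_drop size_tuple mulr_sumr.
under eq_bigr do rewrite perm_tail_sum//.
rewrite sumr_const card_ord -mulr_natl.
under [RHS]eq_bigr do rewrite mxE -mulrA mulr_suml.
rewrite -mulr_sumr; congr (_ * _).
under [RHS]eq_bigr do rewrite big_mkcond.
rewrite exchange_big /= big_mkcond; apply: eq_bigr => J _.
case/tupleP: J => a J; case/tupleP: J => b J /=.
rewrite !drop0 !take0 !eqseq_cons eqxx !andbT.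
under [RHS]eq_bigr do rewrite !eqseq_cons eqxx andbT.
case: eqVneq => [_|_] /=; last by rewrite big1.
rewrite [RHS](bigD1 b)//= eqxx [X in _ + X]big1 ?addr0.
  by rewrite mulrA mulrAC.
by move=> j /negPf jb; rewrite eq_sym jb.
Qed.

(** * Perron theory of the linearised problem *)

Definition irreducible_mx (R : numDomainType) (n : nat) (A : 'M[R]_n) : Prop :=
  (forall i j, 0 <= A i j) /\
  (forall i j, connect (fun k l => 0 < A k l) i j).

Lemma irreducible_mx_tr (R : numDomainType) (n : nat) (A : 'M[R]_n) :
  irreducible_mx A -> irreducible_mx A^T.
Proof.
move=> [A0 Ac]; split=> i j; first by rewrite mxE.
rewrite (@eq_connect _ _ (fun k l => 0 < A l k)) => [|k l]; last by rewrite mxE.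
by have := Ac j i; rewrite connect_rev.
Qed.

(** Where [g] vanishes, a sum of nonnegative terms [A i j * g j] vanishes, so the zero spreads along
    every edge and hence everywhere. *)
Lemma irreducible_eigen0 (R : realDomainType) (n : nat) (A : 'M[R]_n) (tau : R)
    (g : 'cV[R]_n) i0 :
  irreducible_mx A -> (forall i, 0 <= g i 0) -> A *m g = tau *: g ->
  g i0 0 = 0 -> g = 0.
Proof.
move=> [A0 Ac] g0 Ag gi0.
have step i j : g i 0 = 0 -> 0 < A i j -> g j 0 = 0.
  move=> gi Aij; have /eqP : (A *m g) i 0 = 0 by rewrite Ag mxE gi mulr0.
  rewrite mxE psumr_eq0 => [|k _]; last by rewrite mulr_ge0.
  move=> /allP/(_ j (mem_index_enum _)) /=.
  by rewrite mulf_eq0 gt_eqF//= => /eqP.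
apply/matrixP => j k; rewrite ord1 mxE.
have /connectP[s + ->] := Ac i0 j.
elim: s i0 gi0 => [|i s IH] i0 gi0 /=; first by [].
by move=> /andP[i0i]; apply: IH; apply: step i0i.
Qed.

(** With [t] the least ratio [h j / p j], the vector [h - t p] is nonnegative, solves the same
    equation and has a zero entry. *)
Lemma irreducible_eigen_simple (R : realFieldType) (n : nat) (A : 'M[R]_n)
    (tau : R) (p h : 'cV[R]_n) :
  irreducible_mx A -> positive_vec p -> A *m p = tau *: p ->
  A *m h = tau *: h -> exists t, h = t *: p.
Proof.
(* The minimum needs an index, so dimension 0 is treated apart. *)
case: n A p h => [|n] A p h Airr p0 Ap Ah.
  by exists 0; apply/matrixP => -[].
have [k _ kmin] := @arg_minP _ _ _ ord0 xpredT (fun j => h j 0 / p j 0) erefl.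
set t := h k 0 / p k 0 in kmin; exists t.
have tp j : (t *: p) j 0 = t * p j 0 by rewrite mxE.
apply/eqP; rewrite -subr_eq0; apply/eqP.
apply: (@irreducible_eigen0 _ _ A tau _ k) => // [i||].
- by rewrite 2!mxE tp subr_ge0 -ler_pdivlMr//; exact: kmin.
- by rewrite mulmxBr Ah -scalemxAr Ap scalerBr scalerA mulrC -scalerA.
- by rewrite 2!mxE tp divfK ?subrr// gt_eqF.
Qed.

(** Since [tau] is an eigenvalue of [A], it has a left eigenvector [v]; the entrywise modulus [q] of
    [v] satisfies A^T q >= tau q, and equality follows. Irreducibility of the transpose then gives
    positivity and uniqueness up to scaling. *)
Lemma left_perron_exists (R : realFieldType) (n : nat) (A : 'M[R]_n)
    (tau : R) (u : 'cV[R]_n) :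
  (1 <= n)%N -> irreducible_mx A -> positive_vec u -> A *m u = tau *: u ->
  exists w : 'cV[R]_n,
    [/\ positive_vec w, A^T *m w = tau *: w, w^T *m u = 1%:M
      & forall w' : 'cV[R]_n, A^T *m w' = tau *: w' -> w'^T *m u = 1%:M ->
          w' = w].
Proof.
move=> n1 Airr u0 Au; have [A0 Ac] := Airr.
have uN0 : u^T != 0.
  apply/eqP => /matrixP/(_ 0 (Ordinal n1)); rewrite !mxE => uE.
  by have := u0 (Ordinal n1); rewrite uE ltxx.
have : \det (A - tau%:M)^T == 0.
  apply/det0P; exists u^T => //.
  by rewrite -trmx_mul mulmxBl Au mul_scalar_mx subrr trmx0.
rewrite det_tr => /det0P[v vN0 vA].
have vA' : v *m A = tau *: v.
  by apply/eqP; rewrite -subr_eq0 -mul_mx_scalar -mulmxBr vA.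
pose q : 'cV[R]_n := \col_i `|v 0 i|.
have q0 i : 0 <= q i 0 by rewrite mxE.
have gap i : 0 <= (A^T *m q - `|tau| *: q) i 0.
  have -> : (A^T *m q - `|tau| *: q) i 0 = (A^T *m q) i 0 - `|tau| * `|v 0 i|.
    by rewrite !mxE.
  rewrite subr_ge0 -normrM.
  have -> : tau * v 0 i = (v *m A) 0 i by rewrite vA' mxE.
  rewrite mxE (le_trans (ler_norm_sum _ _ _))// mxE ler_sum// => k _.
  by rewrite normrM !mxE mulrC (ger0_norm (A0 _ _)).
have tau0 : 0 <= tau.
  rewrite -(pmulr_lge0 _ (u0 (Ordinal n1))).
  have -> : tau * u (Ordinal n1) 0 = (A *m u) (Ordinal n1) 0 by rewrite Au mxE.
  by rewrite mxE sumr_ge0// => k _; rewrite mulr_ge0// ltW.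
rewrite ger0_norm// in gap.
(* Pairing with u kills the nonnegative gap [A^T q - tau q], so it vanishes. *)
have qA : A^T *m q = tau *: q.
  apply/eqP; rewrite -subr_eq0; apply/eqP/matrixP => i j; rewrite ord1 [RHS]mxE.
  have /eqP : (u^T *m (A^T *m q - tau *: q)) 0 0 = 0.
    by rewrite mulmxBr mulmxA -trmx_mul Au -scalemxAr linearZ /= -scalemxAl subrr mxE.
  rewrite mxE psumr_eq0 => [|k _]; last by rewrite mulr_ge0// mxE ltW.
  move=> /allP/(_ i (mem_index_enum _)) /=.
  by rewrite mulf_eq0 mxE gt_eqF//= => /eqP.
have Atirr := irreducible_mx_tr Airr.
have q_gt0 i : 0 < q i 0.
  rewrite lt_neqAle q0 andbT eq_sym; apply: contra vN0 => /eqP qi.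
  have /matrixP qE := irreducible_eigen0 Atirr q0 qA qi.
  apply/eqP/matrixP => a b; rewrite ord1 [RHS]mxE; apply/eqP.
  by have /eqP := qE b 0; rewrite !mxE normr_eq0.
pose c := (q^T *m u) 0 0.
have c0 : 0 < c.
  rewrite /c mxE (bigD1 (Ordinal n1))//= ltr_pwDl//.
    by rewrite mxE mulr_gt0.
  by apply: sumr_ge0 => k _; rewrite mxE mulr_ge0// ltW.
have cE : q^T *m u = c%:M by apply/matrixP => i j; rewrite !ord1 [RHS]mxE eqxx.
exists (c^-1 *: q); split.
- by move=> i; rewrite mxE mulr_gt0// invr_gt0.
- by rewrite -scalemxAr qA !scalerA mulrC.
- by rewrite linearZ /= -scalemxAl cE scale_scalar_mx mulVf// gt_eqF.
- move=> w' Aw' w'u.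
  have [t w'E] := irreducible_eigen_simple Atirr q_gt0 qA Aw'.
  have : t * c = 1.
    have /matrixP/(_ 0 0) := w'u; rewrite w'E linearZ /= -scalemxAl cE.
    by rewrite scale_scalar_mx !mxE eqxx.
  move=> tc; rewrite w'E; congr (_ *: _); apply: (mulIf (lt0r_neq0 c0)).
  by rewrite tc mulVf// gt_eqF.
Qed.

Lemma diag_mxX (K : comPzRingType) (n : nat) (v : 'rV[K]_n) k :
  diag_mx v ^+ k = diag_mx (map_mx (fun x => x ^+ k) v).
Proof.
elim: k => [|k IH].
  rewrite expr0; apply/matrixP => i j; rewrite !mxE expr0.
  by case: eqVneq.
rewrite exprS IH; apply/matrixP => i j.
rewrite -[_ * _]/(_ *m _) mul_diag_mx !mxE exprS.
by case: eqVneq => [->|]; rewrite ?mulr1n// !mulr0n mulr0.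
Qed.

Lemma invmx_diag_mul (K : fieldType) (n m : nat) (v : 'rV[K]_n)
    (B : 'M[K]_(n, m)) i j :
  (forall i, v 0 i != 0) -> (invmx (diag_mx v) *m B) i j = (v 0 i)^-1 * B i j.
Proof.
move=> v0.
have E : diag_mx v *m diag_mx (map_mx GRing.inv v) = 1%:M.
  rewrite mulmx_diag; apply/matrixP => k l; rewrite !mxE mulfV//.
have Eu : diag_mx v \in unitmx by case/mulmx1_unit: E.
have -> : invmx (diag_mx v) = diag_mx (map_mx GRing.inv v).
  by rewrite -[LHS]mulmx1 -E mulKmx.
by rewrite mul_diag_mx !mxE.
Qed.

Lemma tensor_deriv_ge0 (R : numDomainType) (n d : nat) (T : tensor R n d)
    (u : 'cV[R]_n) i j :
  nonneg_tensor T -> positive_vec u -> 0 <= tensor_deriv T u i j.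
Proof.
move=> T0 u0; rewrite mxE mulr_ge0// sumr_ge0// => J _.
by rewrite mulr_ge0// prodr_ge0// => k _; exact: ltW.
Qed.

(** An edge allows [j] anywhere in the tail, while [tensor_deriv] fixes it in second position;
    differentiating along the [j]-th unit vector bridges the two. *)
Lemma tensor_deriv_gt0 (R : numDomainType) (n d : nat) (T : tensor R n d)
    (u : 'cV[R]_n) i j :
  (2 <= d)%N -> partially_symmetric T -> nonneg_tensor T -> positive_vec u ->
  tensor_edge T i j -> 0 < tensor_deriv T u i j.
Proof.
move=> d2 Tps T0 u0 /existsP[J /and3P[/eqP Ji jJ TJ]].
have := @tensor_deriv_mul _ _ _ T u (fun k => (k == j)%:R) i d2 Tps.
rewrite [in X in _ = X -> _](bigD1 j)//= eqxx mulr1.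
rewrite [X in _ + X]big1 ?addr0 => [<-|k /negPf ->].
  rewrite (bigD1 J) ?Ji//= ltr_pwDl//.
    by rewrite mulr_gt0// (@prod_deriv_gt0 _ _ _ _ _ j) ?eqxx ?ltr01.
  apply: sumr_ge0 => J' _; rewrite mulr_ge0// prod_deriv_ge0// => k.
  exact: ltW.
by rewrite mulr0.
Qed.

(** Euler's identity for forms of degree [d - 1]. *)
Lemma tensor_deriv_mul_self (K : comPzRingType) (n d : nat) (T : tensor K n d)
    (u : 'cV[K]_n) :
  (2 <= d)%N -> partially_symmetric T ->
  tensor_deriv T u *m u = (d - 1)%:R *: tensor_app T u.
Proof.
move=> d2 Tps; apply/matrixP => i j; rewrite ord1 mxE.
rewrite -(tensor_deriv_mul u (u ^~ 0) i d2 Tps) !mxE mulr_sumr.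
apply: eq_bigr => J _.
by rewrite prod_deriv_id size_drop size_tuple mulrCA.
Qed.

Lemma strict_diff_prod (R : realType) (I : finType) (n : nat)
    (a : {ffun I -> R[i]}) (u : 'cV[R[i]]_n) (s : seq 'I_n) :
  strict_diff a u (fun _ y => \prod_(k <- s) y k 0)
    (fun j => prod_deriv (u ^~ 0) (fun k => (j == k)%:R) s).
Proof.
elim: s => [|k s IH].
  by apply: strict_diff_ext (strict_diff_cst _ _ 1) => [x y|j]; rewrite ?big_nil.
by apply: strict_diff_ext (strict_diffM (strict_diff_var _ _ k) IH) => [x y|j];
  rewrite ?big_cons.
Qed.

(** * First-order expansions with quadratic error in a real parameter *)

Definition quad_expansion (R : numDomainType) (f : R -> R) (a b : R) : Prop :=
  exists2 C, 0 <= C & forall e, 0 <= e <= 1 -> `|f e - (a + b * e)| <= C * e ^+ 2.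

Section QuadExpansion.
Variable R : realFieldType.
Implicit Types (f g : R -> R) (a b : R).

Lemma quad_expansion_ext f g a b :
  f =1 g -> quad_expansion f a b -> quad_expansion g a b.
Proof. by move=> fg [C C0 H]; exists C => // e e01; rewrite -fg H. Qed.

Lemma quad_expansion_affine a b : quad_expansion (fun e => a + b * e) a b.
Proof. by exists 0 => // e _; rewrite subrr normr0 mul0r. Qed.

Lemma quad_expansion_cst a : quad_expansion (fun=> a) a 0.
Proof.
by apply: quad_expansion_ext (quad_expansion_affine a 0) => e; rewrite mul0r addr0.
Qed.

Lemma quad_expansionD f g a b a' b' :
  quad_expansion f a b -> quad_expansion g a' b' ->
  quad_expansion (fun e => f e + g e) (a + a') (b + b').
Proof.
move=> [C C0 H] [C' C'0 H']; exists (C + C') => [|e e01]; first exact: addr_ge0.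
have -> : f e + g e - (a + a' + (b + b') * e)
  = (f e - (a + b * e)) + (g e - (a' + b' * e)) by ring.
by rewrite (le_trans (ler_normD _ _))// mulrDl lerD ?H ?H'.
Qed.

Lemma quad_expansionM f g a b a' b' :
  quad_expansion f a b -> quad_expansion g a' b' ->
  quad_expansion (fun e => f e * g e) (a * a') (b * a' + a * b').
Proof.
move=> [C C0 H] [C' C'0 H'].
exists (C * (`|a'| + `|b'| + C') + (`|a| + `|b|) * C' + `|b * b'|) => [|e e01].
  by rewrite !(addr_ge0, mulr_ge0).
have /andP[e0 e1] := e01; have {}H := H e e01; have {}H' := H' e e01.
have e2 : e ^+ 2 <= 1 by rewrite expr_le1.
have affine_le x y : `|x + y * e| <= `|x| + `|y|.
  apply: le_trans (ler_normD _ _) _; rewrite lerD2l normrM (ger0_norm e0).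
  by rewrite ler_piMr.
have g_le : `|g e| <= `|a'| + `|b'| + C'.
  rewrite -[g e](subrK (a' + b' * e)) addrC.
  apply: le_trans (ler_normD _ _) _; apply: lerD => //.
  by apply: le_trans H' _; rewrite ler_piMr.
have -> : f e * g e - (a * a' + (b * a' + a * b') * e) =
  (f e - (a + b * e)) * g e + (a + b * e) * (g e - (a' + b' * e))
  + b * b' * e ^+ 2 by ring.
apply: le_trans (ler_normD _ _) _; rewrite [leRHS]mulrDl; apply: lerD; last first.
  by rewrite normrM [X in _ * X]ger0_norm ?exprn_ge0.
apply: le_trans (ler_normD _ _) _; rewrite !normrM [leRHS]mulrDl; apply: lerD.
  by rewrite mulrAC ler_pM.
by rewrite -mulrA ler_pM.
Qed.

Lemma quad_expansion_sum (J : Type) (s : seq J) (P : pred J)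
    (F : J -> R -> R) (a b : J -> R) :
  (forall j, P j -> quad_expansion (F j) (a j) (b j)) ->
  quad_expansion (fun e => \sum_(j <- s | P j) F j e)
    (\sum_(j <- s | P j) a j) (\sum_(j <- s | P j) b j).
Proof.
move=> H; elim: s => [|j s IH].
  rewrite !big_nil; apply: quad_expansion_ext (quad_expansion_cst 0) => e.
  by rewrite big_nil.
rewrite !big_cons; have [Pj|/negPf Pj] := ifPn.
  apply: quad_expansion_ext (quad_expansionD (H j Pj) IH) => e.
  by rewrite big_cons Pj.
by apply: quad_expansion_ext IH => e; rewrite big_cons Pj.
Qed.

Lemma quad_expansion_prod (n : nat) (u y : 'I_n -> R) (s : seq 'I_n) :
  quad_expansion (fun e => \prod_(k <- s) (u k + y k * e))
    (\prod_(k <- s) u k) (prod_deriv u y s).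
Proof.
elim: s => [|k s IH].
  rewrite big_nil; apply: quad_expansion_ext (quad_expansion_cst 1) => e.
  by rewrite big_nil.
rewrite big_cons /=.
apply: quad_expansion_ext (quad_expansionM (quad_expansion_affine _ _) IH) => e.
by rewrite big_cons.
Qed.

Lemma quad_expansionX f a b k :
  quad_expansion f a b ->
  quad_expansion (fun e => f e ^+ k) (a ^+ k) (k%:R * a ^+ k.-1 * b).
Proof.
move=> fab; elim: k => [|k IH].
  rewrite expr0 !mul0r; apply: quad_expansion_ext (quad_expansion_cst 1) => e.
  by rewrite expr0.
have -> : k.+1%:R * a ^+ k.+1.-1 * b = b * a ^+ k + a * (k%:R * a ^+ k.-1 * b).
  rewrite -natr1 /=; case: k {IH} => [|k] /=; first by rewrite expr0; ring.
  by rewrite exprS; ring.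
rewrite exprS; apply: quad_expansion_ext (quad_expansionM fab IH) => e.
by rewrite exprS.
Qed.

End QuadExpansion.

(** * The Jacobian of the normalised eigenvector equation *)

Section Jacobian.
Variables (R : realFieldType) (n d : nat) (T : tensor R n d) (u w : 'cV[R]_n).
Variable rho : R.
Hypotheses (n1 : (1 <= n)%N) (d3 : (3 <= d)%N).
Hypotheses (Tps : partially_symmetric T) (T0 : nonneg_tensor T).
Hypotheses (Tirr : weakly_irreducible T) (u0 : positive_vec u).
Hypothesis Tu : tensor_app T u = rho *: hadamard_exp u (d - 1).

Let d2 : (2 <= d)%N. Proof. exact: ltnW. Qed.
Let d1E : (d - 1 = (d - 2).+1)%N.
Proof. by case: d d3 => [|[]]//= k; rewrite !subSS !subn0. Qed.
Let tau := (d - 1)%:R * rho.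
Let Dinv : 'M[R]_n := invmx (diag_mx u^T ^+ (d - 2)).
Let A : 'M[R]_n := Dinv *m tensor_deriv T u.
Let uX_gt0 i k : 0 < u i 0 ^+ k. Proof. by rewrite exprn_gt0. Qed.
Let uX_neq0 i k : u i 0 ^+ k != 0. Proof. by rewrite gt_eqF. Qed.

Lemma Dinv_mulE m (B : 'M[R]_(n, m)) i j :
  (Dinv *m B) i j = (u i 0 ^+ (d - 2))^-1 * B i j.
Proof.
rewrite /Dinv diag_mxX invmx_diag_mul ?mxE// => k; rewrite !mxE; exact: uX_neq0.
Qed.

Lemma perron_matrix_irreducible : irreducible_mx A.
Proof.
split=> i j; first by rewrite Dinv_mulE mulr_ge0 ?invr_ge0 ?tensor_deriv_ge0// ltW.
apply: connect_sub (Tirr i j) => k l kl; apply: connect1.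
by rewrite Dinv_mulE mulr_gt0 ?invr_gt0 ?tensor_deriv_gt0.
Qed.

Lemma perron_matrix_eigen : A *m u = tau *: u.
Proof.
rewrite /A -mulmxA tensor_deriv_mul_self// Tu.
apply/matrixP => i j; rewrite ord1 Dinv_mulE !mxE d1E exprS.
by rewrite /tau d1E -!mulrA; field; exact: uX_neq0.
Qed.

Hypotheses (wA : A^T *m w = tau *: w) (wu : w^T *m u = 1%:M).

(** The derivative at [y = u] of T(y) - (rho + w^T (y - u)) y^(d-1), taken entrywise; the last
    summand is the rank-one contribution of the varying eigenvalue. *)
Definition eigen_jacobian : 'M[R]_n :=
  \matrix_(i, j) (tensor_deriv T u i j
    - ((d - 1)%:R * rho * u i 0 ^+ (d - 2) * (j == i)%:R
       + u i 0 ^+ (d - 1) * w j 0)).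

Lemma Dinv_jacobian : Dinv *m eigen_jacobian = A - tau%:M - u *m w^T.
Proof.
apply/matrixP => i j; rewrite Dinv_mulE.
have subE (X Y : 'M[R]_n) : (X - Y) i j = X i j - Y i j by rewrite !mxE.
have uwE : (u *m w^T) i j = u i 0 * w j 0 by rewrite mxE big_ord1 !mxE.
have tauE : tau%:M i j = tau * (j == i)%:R by rewrite mxE eq_sym mulr_natr.
rewrite !subE uwE tauE.
rewrite Dinv_mulE mxE /tau d1E exprS; set x := (j == i)%:R.
by field; exact: uX_neq0.
Qed.

Lemma left_perron_A : w^T *m A = tau *: w^T.
Proof. by rewrite -[A]trmxK -trmx_mul wA linearZ. Qed.

(** The functional w^T [Dinv] annihilates the part [A - tau] and meets u w^T in w^T, because w^T u =
    1. This identifies the first-order coefficient of the eigenvalue. *)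
Lemma jacobian_functional (y b : 'cV[R]_n) :
  eigen_jacobian *m y = - b -> w^T *m y = w^T *m Dinv *m b.
Proof.
move=> Jy; have : w^T *m Dinv *m (eigen_jacobian *m y) = - (w^T *m Dinv *m b).
  by rewrite Jy mulmxN.
rewrite mulmxA -(mulmxA w^T) Dinv_jacobian !mulmxBr left_perron_A.
rewrite mul_mx_scalar subrr sub0r mulmxA wu mul1mx mulNmx.
by move/oppr_inj.
Qed.

(** A kernel vector [h] has w^T h = 0, so A h = tau h; simplicity gives h = t u, and pairing with
    [w] gives t = 0. *)
Lemma jacobian_unit : eigen_jacobian \in unitmx.
Proof.
rewrite unitmxE unitfE -det_tr; apply/negP => /det0P[v vN0 vJ].
case/eqP: vN0; pose h := v^T.
have Jh : eigen_jacobian *m h = - 0.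
  by rewrite oppr0 /h -[eigen_jacobian]trmxK -trmx_mul vJ trmx0.
have wh : w^T *m h = 0 by rewrite (jacobian_functional Jh) mulmx0.
have Ah : A *m h = tau *: h.
  apply/eqP; rewrite -subr_eq0 -mul_scalar_mx -mulmxBl.
  have : (A - tau%:M - u *m w^T) *m h = 0.
    by rewrite -Dinv_jacobian -mulmxA Jh oppr0 mulmx0.
  by rewrite (mulmxBl (A - tau%:M)) -(mulmxA u) wh mulmx0 subr0 => ->.
have [t hE] := irreducible_eigen_simple perron_matrix_irreducible u0
  perron_matrix_eigen Ah.
move: wh; rewrite hE -scalemxAr wu => /matrixP/(_ 0 0).
rewrite !mxE eqxx mulr1 => t0.
by rewrite -[v]trmxK -/h hE t0 scale0r trmx0.
Qed.

(** In the expansion in [e], the constant terms cancel by the eigenvector equation for [u] and the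
    linear terms by the linearised equation for [y]. *)
Lemma eigen_residual (S : tensor R n d) (y : 'cV[R]_n) i :
  eigen_jacobian *m y = - tensor_app S u ->
  exists2 C, 0 <= C & forall e, 0 <= e <= 1 ->
    `|tensor_app ([ffun J => T J + e * S J] : tensor R n d) (u + e *: y) i 0
      - (rho + e * (w^T *m y) 0 0) * (u + e *: y) i 0 ^+ (d - 1)| <= C * e ^+ 2.
Proof.
move=> Jy; set k := (w^T *m y) 0 0.
have vE e j : (u + e *: y) j 0 = u j 0 + y j 0 * e by rewrite !mxE [e * _]mulrC.
have E1 : quad_expansion
    (fun e => tensor_app ([ffun J => T J + e * S J] : tensor R n d) (u + e *: y) i 0)
    (tensor_app T u i 0)
    (tensor_app S u i 0 + \sum_j tensor_deriv T u i j * y j 0).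
  rewrite -tensor_deriv_mul// !mxE -big_split /=.
  apply: quad_expansion_ext (quad_expansion_sum _ (fun (J : d.-tuple 'I_n) _ =>
    quad_expansionM (quad_expansion_affine (T J) (S J))
      (quad_expansion_prod (u ^~ 0) (y ^~ 0) (drop 1 J)))) => e.
  rewrite mxE; apply: eq_bigr => J _; rewrite ffunE [e * _]mulrC; congr (_ * _).
  by apply: eq_bigr => j _; rewrite vE.
have E2 := quad_expansionM (quad_expansion_affine rho k)
  (quad_expansionX (d - 1) (quad_expansion_affine (u i 0) (y i 0))).
have [C C0 H] := quad_expansionD E1 (quad_expansionM (quad_expansion_cst (-1)) E2).
exists C => // e e01; rewrite vE [e * k]mulrC -mulN1r.
apply: le_trans (H e e01); rewrite le_eqVlt; apply/orP; left; apply/eqP.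
congr `|_|; rewrite -[LHS]subr0; congr (_ - _); rewrite Tu !mxE mulN1r subrr add0r.
have : (eigen_jacobian *m y) i 0 = - tensor_app S u i 0 by rewrite Jy mxE.
rewrite mxE (eq_bigr (fun j => tensor_deriv T u i j * y j 0 -
  ((d - 1)%:R * rho * u i 0 ^+ (d - 2) * ((j == i)%:R * y j 0)
   + u i 0 ^+ (d - 1) * (w j 0 * y j 0)))); last by move=> j _; rewrite mxE; ring.
rewrite sumrB big_split /= -!mulr_sumr.
have -> : \sum_j (j == i)%:R * y j 0 = y i 0.
  rewrite (bigD1 i)//= eqxx mul1r big1 ?addr0// => j /negPf ->.
  by rewrite mul0r.
have -> : \sum_j w j 0 * y j 0 = k.
  by rewrite /k mxE; apply: eq_bigr => j _; rewrite mxE.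
have -> : (d - 1).-1 = (d - 2)%N by rewrite d1E.
rewrite [tensor_app S u i 0]mxE => E3.
set Y := \sum_j tensor_deriv _ _ _ _ * _ in E3 *.
set X := \sum_(J | _) _ in E3 *.
have -> : Y = - X + ((d - 1)%:R * rho * u i 0 ^+ (d - 2) * y i 0
                     + u i 0 ^+ (d - 1) * k).
  by rewrite -E3 subrK.
by ring.
Qed.

End Jacobian.

(** * The perturbed eigenpair *)

Lemma tensor_deriv_map (K K' : pzRingType) (f : {rmorphism K -> K'})
    (n d : nat) (T : tensor K n d) (x : 'cV[K]_n) :
  tensor_deriv [ffun J => f (T J)] (map_mx f x) = map_mx f (tensor_deriv T x).
Proof.
apply/matrixP => i j; rewrite !mxE rmorphM rmorph_nat rmorph_sum.
congr (_ * _); apply: eq_bigr => J _.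
rewrite ffunE rmorphM rmorph_prod; congr (_ * _).
by apply: eq_bigr => k _; rewrite mxE.
Qed.

(* The eigenvector equation normalised by lambda = rho + w^T (y - u), which
   removes the scaling freedom of the eigenvector without an extra unknown. *)
Definition eigen_map (K : pzRingType) (n d : nat) (u w : 'cV[K]_n) (rho : K)
    (Q : tensor K n d) (y : 'cV[K]_n) : 'cV[K]_n :=
  tensor_app Q y - (rho + (w^T *m (y - u)) 0 0) *: hadamard_exp y (d - 1).

Lemma eigen_map_map (K K' : pzRingType) (f : {rmorphism K -> K'}) (n d : nat)
    (u w : 'cV[K]_n) rho (Q : tensor K n d) (y : 'cV[K]_n) :
  eigen_map (map_mx f u) (map_mx f w) (f rho) [ffun J => f (Q J)] (map_mx f y)
    = map_mx f (eigen_map u w rho Q y).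
Proof.
rewrite /eigen_map tensor_app_map hadamard_exp_map map_mxB map_mxZ rmorphD.
by rewrite -map_mxB map_trmx -map_mxM [map_mx f (_ *m _) 0 0]mxE.
Qed.

Section EigenBranch.
Variables (R : realType) (n d : nat) (T : tensor R n d) (u w : 'cV[R]_n).
Variable rho : R.
Hypotheses (d3 : (3 <= d)%N) (Tps : partially_symmetric T).
Hypothesis Tu : tensor_app T u = rho *: hadamard_exp u (d - 1).

Local Notation toC := (real_complex R).
Local Notation J := (eigen_jacobian T u w rho).
Hypothesis Ju : J \in unitmx.

Let TC := complexify T.
Let uC := map_mx toC u.
Let wC := map_mx toC w.
Let rhoC := toC rho.
Let F := @eigen_map R[i] n d uC wC rhoC.

Lemma eigen_map_strict_diff i :
  strict_diff TC uC (fun Q y => F Q y i 0) (fun j => toC (J i j)).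
Proof.
have TCps : partially_symmetric TC.
  by move=> I1 I2 h1 h2; rewrite !ffunE (Tps h1 h2).
have D1 := strict_diff_sum (index_enum _)
  (P := fun I : d.-tuple 'I_n => take 1 I == [:: i])
  (fun (I : d.-tuple 'I_n) _ => strict_diffM (strict_diff_param TC uC I)
                    (strict_diff_prod TC uC (drop 1 I))).
have D2 : strict_diff TC uC (fun _ y => rhoC + \sum_j wC j 0 * (y j 0 - uC j 0))
    (fun j => wC j 0).
  have := strict_diffD (strict_diff_cst TC uC rhoC)
    (strict_diff_sum (index_enum _) (P := xpredT) (fun (j : 'I_n) _ =>
      strict_diffM (strict_diff_cst TC uC (wC j 0))
        (strict_diffD (strict_diff_var TC uC j) (strict_diff_cst TC uC (- uC j 0))))).
  apply: strict_diff_ext => // j; rewrite add0r (bigD1 j)//= big1 ?addr0.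
    by rewrite eqxx mul0r add0r ?addr0 mulr1.
  by move=> k /negPf kj; rewrite eq_sym kj mul0r add0r ?addr0 mulr0.
have := strict_diffD D1 (strict_diffN
  (strict_diffM D2 (strict_diffX (d - 1) (strict_diff_var TC uC i)))).
apply: strict_diff_ext => [Q y|j].
  rewrite /F /eigen_map !mxE; congr (_ - (_ + _) * _).
  by apply: eq_bigr => k _; rewrite !mxE.
have -> : \sum_(I : d.-tuple 'I_n | take 1 I == [:: i])
    (0 * \prod_(k <- drop 1 I) uC k 0 +
     TC I * prod_deriv (uC^~ 0) (fun k => (j == k)%:R) (drop 1 I))
    = toC (tensor_deriv T u i j).
  under eq_bigr do rewrite mul0r add0r.
  rewrite tensor_deriv_mul ?(ltnW d3)// (bigD1 j)//= eqxx mulr1 big1 ?addr0.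
    by rewrite /TC /complexify (tensor_deriv_map toC) mxE.
  by move=> k /negPf kj; rewrite eq_sym kj mulr0.
(* At [y = uC] the correction to the eigenvalue vanishes, leaving the factor [rhoC]. *)
rewrite [\sum_j _]big1 ?addr0; last by move=> k _; rewrite subrr mulr0.
rewrite !mxE rmorphB rmorphD !rmorphM !rmorphXn !rmorph_nat; congr (_ - _).
rewrite -subnS addrC mulrC [toC (u i 0) ^+ _ * _]mulrC; congr (_ + _).
by rewrite mulrC !mulrA [rhoC * _]mulrC.
Qed.

(** The zeros of [F] are the fixed points of the Newton map whose inverse Jacobian is frozen at the
    base point; the derivative of this map in [y] vanishes there. *)
Lemma eigen_branch (e : R) : 0 < e ->
  exists (z : tensor R[i] n d -> 'cV[R[i]]_n) (delta r : R),
    [/\ 0 < r, 0 < delta <= e, z TC = uC &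
      forall Q : tensor R[i] n d, (forall I, cabs (Q I - TC I) < r) ->
      [/\ forall c (l : 'I_n -> R[i]) E,
            analytic_at_within E (fun Q => c + \sum_j l j * z Q j 0) Q,
          F Q (z Q) = 0,
          forall i, cabs (z Q i 0 - uC i 0) <= delta
        & forall y : 'cV[R[i]]_n, (forall i, cabs (y i 0 - uC i 0) <= delta) ->
            F Q y = 0 -> y = z Q]].
Proof.
move=> e0; pose JC := map_mx toC J.
have JCu : JC \in unitmx by rewrite map_unitmx.
pose Phi (Q : tensor R[i] n d) y := y - invmx JC *m F Q y.
have PhiE Q y : (Phi Q y = y) <-> (F Q y = 0).
  rewrite /Phi; split=> [/eqP|->]; last by rewrite mulmx0 subr0.
  rewrite -[X in _ == X]subr0 (inj_eq (addrI _)) eqr_opp => /eqP FE.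
  by rewrite -[LHS](mulKVmx JCu) FE mulmx0.
have Fu : F TC uC = 0.
  rewrite /F /TC /complexify eigen_map_map /eigen_map subrr mulmx0.
  by rewrite mxE addr0 Tu subrr map_mx0.
have PhiD i : strict_diff TC uC (fun Q y => Phi Q y i 0) (fun=> 0).
  have := strict_diffD (strict_diff_var TC uC i) (strict_diffN
    (strict_diff_sum (index_enum _) (P := xpredT) (fun (k : 'I_n) _ =>
      strict_diffM (strict_diff_cst TC uC (invmx JC i k))
                   (eigen_map_strict_diff k)))).
  apply: strict_diff_ext => [Q y|j]; first by rewrite !mxE.
  rewrite (eq_bigr (fun k => invmx JC i k * JC k j)).
    have := mulVmx JCu => /matrixP/(_ i j); rewrite !mxE => ->.
    by rewrite eq_sym subrr.
  by move=> k _; rewrite mul0r add0r [JC k j]mxE.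
have [z [delta [r [r0 dle zT zP]]]] :=
  fixed_point_analytic PhiD (proj2 (PhiE _ _) Fu) e0.
exists z, delta, r; split => // Q Qr; have [za zF zd zu] := zP Q Qr.
split => //; first exact/PhiE.
by move=> y yd /PhiE; exact: zu.
Qed.

End EigenBranch.

Lemma conjc_fixed_real (R : rcfType) (x : R[i]) :
  x^*%C = x -> x = (complex.Re x)%:C%C.
Proof.
by case: x => a b [/eqP]; rewrite eqNr => /eqP ->.
Qed.

(** * Perturbation of the spectral radius *)

Section Perturbation.
Variables (R : realType) (n d : nat) (T : tensor R n d) (u w : 'cV[R]_n).
Variable rho : R.
Hypotheses (n1 : (1 <= n)%N) (d3 : (3 <= d)%N) (Tps : partially_symmetric T).
Hypotheses (u0 : positive_vec u).
Hypothesis Tu : tensor_app T u = rho *: hadamard_exp u (d - 1).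
Hypothesis Ju : eigen_jacobian T u w rho \in unitmx.

Local Notation toC := (real_complex R).

Lemma min_entry : exists2 e : R, 0 < e & forall i, e < u i 0.
Proof.
apply: min_pos_family => [i e e' /andP[_ /le_lt_trans]|i]; first exact.
exists (u i 0 / 2); first by rewrite divr_gt0.
by rewrite ltr_pdivrMr// ltr_pMr// ltr1n.
Qed.

(* Complex conjugation fixes the equation at a real tensor, so by local
   uniqueness the branch of eigen_branch is real there. *)
Lemma perturbed_eigenpair : exists2 r : R, 0 < r &
  forall B : tensor R n d, nonneg_tensor B -> (forall I, `|B I - T I| < r) ->
    exists2 x : 'cV[R]_n, positive_vec x &
      tensor_app B x = spectral_radius B *: hadamard_exp x (d - 1).
Proof.
have [e e0 eu] := min_entry.
have [z [delta [r [r0 /andP[_ dle] _ zP]]]] := eigen_branch d3 Tps Tu Ju e0.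
exists r => // B B0 Br.
have Br' I : cabs (complexify B I - complexify T I) < r.
  by rewrite !ffunE -rmorphB cabs_real.
have [_ zF zd zu] := zP _ Br'.
pose conj : {rmorphism R[i] -> R[i]} := @conjc R.
have mapC m (M : 'M[R]_(n, m)) : map_mx conj (map_mx toC M) = map_mx toC M.
  by apply/matrixP => i j; rewrite !mxE; exact: conjc_real.
have zreal : map_mx conj (z (complexify B)) = z (complexify B).
  apply: zu => [i|].
    rewrite -[map_mx toC u]mapC [X in cabs (X - _)]mxE [X in cabs (_ - X)]mxE.
    by rewrite -rmorphB cabs_conj.
  have := congr1 (map_mx conj) zF; rewrite map_mx0 -eigen_map_map !mapC.
  rewrite (_ : conj (toC rho) = toC rho); last exact: conjc_real.
  rewrite (_ : [ffun I => conj (complexify B I)] = complexify B)//.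
  by apply/ffunP => I; rewrite !ffunE; exact: conjc_real.
pose x : 'cV[R]_n := map_mx (@complex.Re R) (z (complexify B)).
have xE : z (complexify B) = map_mx toC x.
  apply/matrixP => i j; rewrite [RHS]mxE [x i j]mxE; apply: conjc_fixed_real.
  by rewrite -[in RHS]zreal mxE.
(* The branch moves each entry by at most [delta <= e], less than the smallest entry of [u]. *)
have x0 : positive_vec x.
  move=> i; have := zd i; rewrite xE !mxE -rmorphB cabs_real.
  by rewrite ler_norml => /andP[+ _]; have := eu i; move: dle; lra.
exists x => //.
pose ell := rho + (w^T *m (x - u)) 0 0.
have Bx : tensor_app B x = ell *: hadamard_exp x (d - 1).
  move: zF; rewrite xE /complexify eigen_map_map => /eqP.
  by rewrite map_mx_eq0 subr_eq0 => /eqP.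
by rewrite (spectral_radius_positive n1 B0 x0 Bx).
Qed.

(** An approximate positive eigenvector [v] is compared with the exact one [x] twice, with the roles
    exchanged, for the lower and the upper bound. *)
Lemma collatz_wielandt_bracket (B : tensor R n d) (x v : 'cV[R]_n) (l m k : R) :
  nonneg_tensor B -> positive_vec x -> positive_vec v ->
  tensor_app B x = l *: hadamard_exp x (d - 1) ->
  (forall i, `|tensor_app B v i 0 - m * v i 0 ^+ (d - 1)| <= k * v i 0 ^+ (d - 1)) ->
  `|l - m| <= k.
Proof.
move=> B0 x0 v0 Bx Bv.
have Bxi i : tensor_app B x i 0 = l * x i 0 ^+ (d - 1) by rewrite Bx !mxE.
have neq0 (y : 'cV[R]_n) : positive_vec y -> y != 0.
  move=> y0; apply/eqP => yE; have := y0 (Ordinal n1).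
  by rewrite yE mxE ltxx.
rewrite ler_norml; apply/andP; split.
  suff: m - k <= l by lra.
  apply: (collatz_wielandt_le (x := v) (y := x) B0) => // [i||i|i].
  - exact: ltW.
  - exact: neq0.
  - by have := Bv i; rewrite ler_norml mulrBl => /andP[+ _]; lra.
  - by rewrite Bxi.
suff: l <= m + k by lra.
apply: (collatz_wielandt_le (x := x) (y := v) B0) => // [i||i|i].
- exact: ltW.
- exact: neq0.
- by rewrite Bxi.
- by have := Bv i; rewrite ler_norml mulrDl => /andP[_]; lra.
Qed.

Lemma nonneg_perturbation (S : tensor R n d) (r : R) :
  nonneg_tensor T -> (forall I, T I = 0 -> 0 <= S I) -> 0 < r ->
  exists2 eps0 : R, 0 < eps0 & forall eps, 0 <= eps < eps0 ->
    nonneg_tensor ([ffun I => T I + eps * S I] : tensor R n d) /\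
    forall I, `|eps * S I| < r.
Proof.
move=> T0 S0 r0.
have [d1 d1_gt0 H1] : exists2 d1 : R, 0 < d1 &
    forall I eps, 0 <= eps < d1 -> 0 <= T I + eps * S I.
  apply: min_pos_family => [I e e' /andP[_ e'e] H eps /andP[eps0 epse]|I].
    by apply: H; rewrite eps0 (lt_le_trans epse).
  have := T0 I; rewrite le_eqVlt => /orP[/eqP TI|TI].
    exists 1 => // eps /andP[eps0 _].
    by rewrite -TI add0r mulr_ge0// S0.
  have S1 : 0 < `|S I| + 1 by rewrite ltr_wpDl.
  (* Below this threshold [eps] times the modulus of [S I] stays under [T I]; the summand 1 avoids
     division by zero. *)
  exists (T I / (`|S I| + 1)); first by rewrite divr_gt0.
  move=> eps /andP[eps0]; rewrite ltr_pdivlMr// => epsT.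
  have : - `|S I| <= S I by rewrite lerNl -normrN ler_norm.
  by nra.
have [d2 d2_gt0 H2] : exists2 d2 : R, 0 < d2 &
    forall I eps, 0 <= eps < d2 -> `|eps * S I| < r.
  apply: min_pos_family => [I e e' /andP[_ e'e] H eps /andP[eps0 epse]|I].
    by apply: H; rewrite eps0 (lt_le_trans epse).
  have S1 : 0 < `|S I| + 1 by rewrite ltr_wpDl.
  exists (r / (`|S I| + 1)); first by rewrite divr_gt0.
  move=> eps /andP[eps0]; rewrite ltr_pdivlMr// normrM (ger0_norm eps0) => epsr.
  by apply: le_lt_trans epsr; rewrite mulrDr mulr1 lerDl.
exists (Num.min d1 d2); first by rewrite lt_min d1_gt0.
move=> eps /andP[eps0]; rewrite lt_min => /andP[e1 e2]; split=> I.
  by rewrite ffunE H1// eps0.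
by rewrite H2// eps0.
Qed.

Lemma spectral_radius_expansion (S : tensor R n d) (y : 'cV[R]_n) :
  nonneg_tensor T -> (forall I, T I = 0 -> 0 <= S I) ->
  eigen_jacobian T u w rho *m y = - tensor_app S u ->
  exists C eps0 : R, 0 < eps0 /\ forall eps, 0 <= eps < eps0 ->
    `|spectral_radius ([ffun I => T I + eps * S I] : tensor R n d)
      - (rho + eps * (w^T *m y) 0 0)| <= C * eps ^+ 2.
Proof.
move=> T0 S0 Jy.
have [r r0 Hr] := perturbed_eigenpair.
have [e1 e1_gt0 He1] := nonneg_perturbation T0 S0 r0.
(* Keeping [u + eps y] above [u / 2] makes it positive and turns the absolute residual into one
   relative to its power [d - 1]. *)
have [e2 e2_gt0 He2] : exists2 e2 : R, 0 < e2 &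
    forall i eps, 0 <= eps < e2 -> u i 0 / 2 <= (u + eps *: y) i 0.
  apply: min_pos_family => [i e e' /andP[_ e'e] H eps /andP[eps0 epse]|i].
    by apply: H; rewrite eps0 (lt_le_trans epse).
  have y1 : 0 < `|y i 0| + 1 by rewrite ltr_wpDl.
  exists (u i 0 / 2 / (`|y i 0| + 1)); first by rewrite !divr_gt0.
  move=> eps /andP[eps0]; rewrite ltr_pdivlMr// => epsu.
  have : - `|y i 0| <= y i 0 by rewrite lerNl -normrN ler_norm.
  by rewrite !mxE; have := u0 i; nra.
have /choice[C HC] i : exists C, 0 <= C /\ forall e, 0 <= e <= 1 ->
    `|tensor_app ([ffun I => T I + e * S I] : tensor R n d) (u + e *: y) i 0
      - (rho + e * (w^T *m y) 0 0) * (u + e *: y) i 0 ^+ (d - 1)| <= C * e ^+ 2.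
  by have [C C0 CP] := eigen_residual d3 Tps Tu i Jy; exists C.
(* The sum of nonnegative terms serves as a common upper bound for the relative residual constants
   of all entries. *)
pose K := \sum_i C i / (u i 0 / 2) ^+ (d - 1).
exists K, (Num.min 1 (Num.min e1 e2)); split.
  by rewrite !lt_min ltr01 e1_gt0.
move=> eps /andP[eps0]; rewrite !lt_min => /and3P[eps1 epse1 epse2].
have [|B0 BT] := He1 eps; first by rewrite eps0.
set B := [ffun I => _] in B0 *.
have [I|x x0 Bx] := Hr B B0.
  by rewrite ffunE addrC addKr.
have vu i : u i 0 / 2 <= (u + eps *: y) i 0 by apply: He2; rewrite eps0.
have u2 i : 0 < u i 0 / 2 by rewrite divr_gt0.
have v0 : positive_vec (u + eps *: y) by move=> i; exact: lt_le_trans (vu i).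
apply: (collatz_wielandt_bracket B0 x0 v0 Bx) => i.
have [C0 /(_ eps)] := HC i; rewrite eps0 ltW// => /(_ isT) /le_trans; apply.
have ui := exprn_gt0 (d - 1) (u2 i).
apply: (@le_trans _ _
  (C i / (u i 0 / 2) ^+ (d - 1) * eps ^+ 2 * (u i 0 / 2) ^+ (d - 1))).
  by rewrite mulrAC divfK ?gt_eqF.
apply: ler_pM.
- by rewrite mulr_ge0 ?sqr_ge0// divr_ge0// ltW.
- exact: ltW.
- rewrite ler_wpM2r ?sqr_ge0// /K (bigD1 i)//= lerDl sumr_ge0// => j _.
  by rewrite divr_ge0 ?exprn_ge0 ?(ltW (u2 j))//; case: (HC j).
- by rewrite lerXn2r// nnegrE ltW.
Qed.

End Perturbation.

Theorem theorem4 (R : realType) (n d : nat) (hn : (1 <= n)%N) (hd : (3 <= d)%N)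
    (T : tensor R n d) (hTps : partially_symmetric T)
    (hTnn : nonneg_tensor T) (hTirr : weakly_irreducible T)
    (u : 'cV[R]_n) (hu : positive_vec u)
    (hTu : tensor_app T u = spectral_radius T *: hadamard_exp u (d - 1)) :
  (exists (z : tensor R[i] n d -> 'cV[R[i]]_n) (lambda : tensor R[i] n d -> R[i])
          (delta : R[i]),
     [/\ 0 < delta,
         forall Q : tensor R[i] n d,
           partially_symmetric Q -> polydisc (complexify T) delta Q ->
           [/\ forall i : 'I_n,
                 analytic_at_within (@partially_symmetric R[i] n d)
                                    (fun Q' => z Q' i 0) Q,
               analytic_at_within (@partially_symmetric R[i] n d) lambda Q
             & tensor_app Q (z Q) = lambda Q *: hadamard_exp (z Q) (d - 1)],
         z (complexify T) = map_mx (real_complex R) u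
       & lambda (complexify T) = (spectral_radius T)%:C%C]) /\
  (let Dinv : 'M[R]_n := invmx (diag_mx u^T ^+ (d - 2)) in
   let A : 'M[R]_n := Dinv *m tensor_deriv T u in
   let left_perron (w : 'cV[R]_n) : Prop :=
     A^T *m w = ((d - 1)%:R * spectral_radius T) *: w /\ w^T *m u = 1%:M in
   exists w : 'cV[R]_n,
     [/\ positive_vec w,
         left_perron w,
         forall w' : 'cV[R]_n, left_perron w' -> w' = w
       & forall S : tensor R n d,
           partially_symmetric S ->
           (forall I : d.-tuple 'I_n, T I = 0 -> 0 <= S I) ->
           exists (C eps0 : R), 0 < eps0 /\
             forall eps : R, 0 <= eps < eps0 ->
               `| spectral_radius ([ffun I => T I + eps * S I] : tensor R n d)
                  - (spectral_radius T
                     + eps * (w^T *m Dinv *m tensor_app S u) 0 0) |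
               <= C * eps ^+ 2]).
Proof.
set rho := spectral_radius T in hTu *.
have Airr := perron_matrix_irreducible hd hTps hTnn hTirr hu.
have Au := perron_matrix_eigen hd hTps hu hTu.
have [w [w0 wA wu w_uniq]] := left_perron_exists hn Airr hu Au.
have Ju := jacobian_unit hd hTps hTnn hTirr hu hTu wA wu.
split.
  have [z [delta [r [r0 _ zT zP]]]] := eigen_branch hd hTps hTu Ju ltr01.
  pose lam Q : R[i] := rho%:C%C + ((map_mx (real_complex R) w)^T
    *m (z Q - map_mx (real_complex R) u)) 0 0.
  exists z, lam, r%:C%C; split => //; first by rewrite ltcR.
    move=> Q _ Qr; have [|za zF _ _] := zP Q.
      by move=> I; rewrite -ltcR -cabsE; exact: Qr.
    split.
    (* [eigen_branch] covers affine combinations of the coordinates of [z]: a coordinate is the one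
       with Kronecker coefficients, and [lam] below is the one with coefficients [w] and constant
       term rho - w^T u. *)
    - move=> i; have zi (Q' : tensor R[i] n d) :
        z Q' i 0 = 0 + \sum_j (j == i)%:R * z Q' j 0.
        rewrite add0r (bigD1 i)//= eqxx mul1r big1 ?addr0// => j /negPf ->.
        by rewrite mul0r.
      by rewrite (funext zi); exact: za.
    - have lamE Q' : lam Q' = (rho%:C%C - \sum_j (w j 0)%:C%C * (u j 0)%:C%C)
        + \sum_j (w j 0)%:C%C * z Q' j 0.
        rewrite /lam mxE -addrA; congr (_ + _).
        rewrite addrC -sumrB; apply: eq_bigr => j _.
        by rewrite !mxE mulrBr.
      by rewrite (funext lamE); exact: za.
    - by apply/eqP; rewrite -subr_eq0; apply/eqP; exact: zF.
  by rewrite /lam zT subrr mulmx0 mxE addr0.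
exists w; split => // [|S _ S0].
  by move=> w' [w'A w'u]; exact: w_uniq.
(* [y] is the first-order displacement of the eigenvector; w^T y becomes the stated coefficient
   through [jacobian_functional]. *)
pose y := invmx (eigen_jacobian T u w rho) *m - tensor_app S u.
have Jy : eigen_jacobian T u w rho *m y = - tensor_app S u by rewrite mulKVmx.
have [C [eps0 [eps0_gt0 H]]] :=
  spectral_radius_expansion hn hd hTps hu hTu Ju hTnn S0 Jy.
exists C, eps0; split => // eps /H.
by rewrite (jacobian_functional hd hu wA wu Jy).
Qed.
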